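(* Assume (A3), (A4), let $q\in(0,1)$, $p\in(0,2]$ with $p<q+1$, and let $x$ be a trajectory solution of (MTRIGS) with initial data $(x_0,v_0)$. Then for every $r\in[q,1)\cap[p-q,1)$, as $t\to+\infty$: (i) $\mathcal E^r_\lambda(t)=O(t^{3r-(p+1)})$ for every $\lambda\in(0,\frac{2\alpha}3]\cap(0,\frac\beta\alpha]$; (ii) $\varphi_t(x(t))=O(t^{r-(p+1)})$; (iii) $\varphi(x(t))=O(t^{-p})$; (iv) $\|x(t)-z(t)\|=O(t^{\frac{r-1}{2}})$; (v) $\|\dot x(t)\|=O(t^{\frac{r-(p+1)}{2}})$.
   Context: $\mathcal H$ real Hilbert space; $f_1,\dots,f_m:\mathcal H\to\mathbb R$ convex, continuously differentiable with Lipschitz continuous gradients; $F=(f_1,\dots,f_m)^\top$. Weak Pareto optimal: no $x$ with $f_i(x)<f_i(x^* )$ for all $i$; $\mathcal P_w$ the set of such points. $\mathcal L(F,b):=\{x:f_i(x)\le b_i\ \forall i\}$, $\mathcal{LP}_w(F,b):=\mathcal L(F,b)\cap\mathcal P_w$. Merit function $\varphi(x):=\sup_z\min_i(f_i(x)-f_i(z))$. Parameters $t_0>0$, $\alpha,\beta>0$, $q\in(0,1]$, $p\in(0,2]$, initial data $x_0,v_0\in\mathcal H$; $C(x):=\operatorname{conv}\{\nabla f_i(x)\}$. A trajectory solution of (MTRIGS) is $x:[t_0,\infty)\to\mathcal H$, continuously differentiable, with $\dot x$ absolutely continuous on each $[t_0,T]$ and a.e. derivative $\ddot x$ (Bochner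 measurable, $\dot x(t)=\dot x(t_0)+\int_{t_0}^t\ddot x$), satisfying $\frac{\alpha}{t^q}\dot x(t)+\operatorname{proj}_{C(x(t))+\frac{\beta}{t^p}x(t)+\ddot x(t)}(0)=0$ for a.e. $t\ge t_0$, $x(t_0)=x_0$, $\dot x(t_0)=v_0$. (A3): with $a_i:=\frac{\beta}{2t_0^p}\|x_0\|^2+\frac12\|v_0\|^2$, for every $x\in\mathcal L(F,F(x_0)+a)$, $\mathcal{LP}_w(F,F(x))\ne\emptyset$, and $R:=\sup_{F^*\in F(\mathcal{LP}_w(F,F(x_0)+a))}\inf_{z\in F^{-1}(\{F^*\})}\|z\|<\infty$. (A4): $S(w):=\operatorname{argmin}_z\max_i(f_i(z)-w_i)\neq\emptyset$ for all $w\in\mathbb R^m$ and $w\mapsto\operatorname{proj}_{S(w)}(0)$ is continuous. $f_{t,i}(x):=f_i(x)+\frac{\beta}{2t^p}\|x\|^2$; $\varphi_t(x):=\sup_z\min_i(f_{t,i}(x)-f_{t,i}(z))$; $z(t):=\operatorname{argmin}_z\max_i(f_{t,i}(z)-f_{t,i}(x(t)))$. For $r\in[q,1]$ and $\lambda>0$: $\mathcal E^r_\lambda(t):=t^{2r}\varphi_t(x(t))+\frac12\|\lambda(x(t)-z(t))+t^r\dot x(t)\|^2+\frac\lambda2\big(rt^{r-1}+\alpha t^{r-q}-2\lambda\big)\|x(t)-z(t)\|^2$. *)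

(* Defs.v *)
From HB Require Import structures.
From mathcomp Require Import all_boot all_order all_algebra.
From mathcomp Require Import all_classical all_reals all_analysis.
Set Implicit Arguments. Unset Strict Implicit. Unset Printing Implicit Defensive.
Import Order.TTheory GRing.Theory Num.Theory.
Import numFieldNormedType.Exports.
Local Open Scope classical_set_scope.
Local Open Scope ring_scope.

Section Defs.
Variables (R : realType) (H : normedModType R).

Definition inner_product (ip : H -> H -> R) : Prop :=
  (forall x y, ip x y = ip y x) /\
  (forall (a : R) x y z, ip (a *: x + y) z = a * ip x z + ip y z) /\
  (forall x, ip x x = `|x| ^+ 2).

Definition convex_fun (g : H -> R) : Prop :=
  forall (x y : H) (s : R), 0 <= s <= 1 ->
    g (s *: x + (1 - s) *: y) <= s * g x + (1 - s) * g y.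

Definition has_gradient (ip : H -> H -> R) (g : H -> R) (x d : H) : Prop :=
  forall e : R, 0 < e -> exists2 del : R, 0 < del &
    forall h : H, `|h| < del -> `|g (x + h) - g x - ip d h| <= e * `|h|.

Variable m : nat.
(* the objectives are indexed by 'I_m.+1, i.e. there are m.+1 >= 1 of them *)
Definition minI (g : 'I_m.+1 -> R) : R := \big[Order.min/g ord0]_i g i.
Definition maxI (g : 'I_m.+1 -> R) : R := \big[Order.max/g ord0]_i g i.

Variable f : 'I_m.+1 -> H -> R.

Definition weak_pareto (xs : H) : Prop := ~ exists y, forall i, f i y < f i xs.
Definition level_set (b : 'I_m.+1 -> R) : set H := [set y | forall i, f i y <= b i].
Definition LPw (b : 'I_m.+1 -> R) : set H := level_set b `&` [set y | weak_pareto y].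

Definition merit (x : H) : \bar R :=
  ereal_sup [set (minI (fun i => f i x - f i z))%:E | z in [set: H]].

Definition argmin_set (g : H -> R) : set H := [set z | forall y, g z <= g y].

Definition is_proj (S : set H) (y p : H) : Prop :=
  S p /\ forall s, S s -> `|p - y| <= `|s - y|.

Definition conv_hull (gr : 'I_m.+1 -> H) : set H :=
  [set y | exists th : 'I_m.+1 -> R, (forall i, 0 <= th i) /\
     \sum_i th i = 1 /\ y = \sum_i th i *: gr i].

Definition f_t (beta p t : R) (i : 'I_m.+1) (x : H) : R :=
  f i x + beta / (2 * t `^ p) * `|x| ^+ 2.

Definition merit_t (beta p t : R) (x : H) : \bar R :=
  ereal_sup [set (minI (fun i => f_t beta p t i x - f_t beta p t i z))%:E
            | z in [set: H]].

Definition A3 (t0 beta p : R) (x0 v0 : H) : Prop :=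
  let a := beta / (2 * t0 `^ p) * `|x0| ^+ 2 + 2^-1 * `|v0| ^+ 2 in
  let b0 := fun i => f i x0 + a in
  (forall x, level_set b0 x -> LPw (fun i => f i x) !=set0) /\
  (ereal_sup [set ereal_inf [set (`|z|)%:E | z in [set z | forall i, f i z = f i y]]
             | y in LPw b0] < +oo)%E.

Definition Sw (w : 'rV[R]_m.+1) : set H :=
  argmin_set (fun z => maxI (fun i => f i z - w ord0 i)).

Definition A4 : Prop :=
  (forall w, Sw w !=set0) /\
  exists P : 'rV[R]_m.+1 -> H, (forall w, is_proj (Sw w) 0 (P w)) /\ continuous P.

End Defs.

Section Traj.
Variables (R : realType) (H : normedModType R).

Definition has_deriv_on (A : set R) (u : R -> H) (s : R) (d : H) : Prop :=
  forall e : R, 0 < e -> exists2 del : R, 0 < del &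
    forall v, A v -> `|v - s| < del -> `|u v - u s - (v - s) *: d| <= e * `|v - s|.

Definition abs_cont_on (a b : R) (u : R -> H) : Prop :=
  forall e : R, 0 < e -> exists2 del : R, 0 < del &
    forall (n : nat) (l r : nat -> R),
      (forall k, (k < n)%N -> a <= l k /\ l k <= r k /\ r k <= b) ->
      (forall k, (k.+1 < n)%N -> r k <= l k.+1) ->
      \sum_(k < n) (r k - l k) < del ->
      \sum_(k < n) `|u (r k) - u (l k)| < e.
End Traj.

Section Energy.
Variables (R : realType) (H : normedModType R) (m : nat) (f : 'I_m.+1 -> H -> R).

Definition energy (alpha beta p q r lam : R) (x z xd : R -> H) (t : R) : \bar R :=
  ((t `^ (2 * r))%:E * merit_t f beta p t (x t) +
   (2^-1 * `|lam *: (x t - z t) + t `^ r *: xd t| ^+ 2 +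
    lam / 2 * (r * t `^ (r - 1) + alpha * t `^ (r - q) - 2 * lam) * `|x t - z t| ^+ 2)%:E)%E.
End Energy.

(* Main.v *)
Require Import Defs.
From HB Require Import structures.
From mathcomp Require Import all_boot all_order all_algebra.
From mathcomp Require Import all_classical all_reals all_analysis.
From mathcomp Require Import lra ring.
Import Order.TTheory GRing.Theory Num.Theory.
Import numFieldNormedType.Exports.
Local Open Scope classical_set_scope.
Local Open Scope ring_scope.

Set Implicit Arguments.
Unset Strict Implicit.

(** The energy is compared along the trajectory with a fixed anchor [y] in place of
    the moving minimizer [z(t)], which need not be absolutely continuous. With
    [u = x - y], the gaps [f_{t,i}(x) - f_{t,i}(y) + |x'|^2 / 2] all have the same a.e.
    upper bound on their derivatives, hence so has their minimum [M], and
    [G = a (M + lam t^-r <u, x'> + k |u|^2)], [a = exp (lam t^(1-r) / (1-r))], equals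
    [a t^(-2r)] times the energy anchored at [y]. For large [t] one gets
    [G' <= a p beta t^(-p-1) |y|^2 / 2], without any sign condition on [M]. Since
    [a t^(r-p-1)] has derivative at least [lam a t^(-p-1) / 2], integrating up to a final
    time [T] and only then choosing [y = z(T)], which is bounded by (A3), gives (i); the
    other rates follow from the strong convexity of the [f_{t,i}].

    Upper bounds on derivatives are expressed by two-sided difference quotients
    ([straddle_le]), since these bounds pass to minima; absolute continuity enters only
    through domination by the increments of the velocity ([dominated_near]). *)

(** * Monotonicity from almost everywhere bounds on difference quotients *)

(** The endpoints move independently on the two sides of [t], which is exactly the situation in the
    step of [real_induction]. *)
Definition straddle_le (R : realType) (g : R -> R) (t c : R) : Prop :=
  forall e, 0 < e -> \forall s \near t & v \near t,
    s <= t -> t <= v -> g v - g s <= (c + e) * (v - s).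

(** A local Lipschitz bound in [u] and time together. The time term lets powers of time, the
    trajectory and its velocity share one calculus. *)
Definition dominated_near (R : realType) (H V : normedModType R)
    (u : R -> H) (g : R -> V) (t : R) : Prop :=
  exists2 K, 0 <= K & \forall s \near t & v \near t,
    `|g v - g s| <= K * (`|u v - u s| + `|v - s|).

(** The supremum of the points of [[a, b]] where [P] holds cannot lie below [b]: the step at the
    supremum carries [P] from a point just before it to points beyond it. *)
Lemma real_induction (R : realType) (a b : R) (P : R -> Prop) :
  a <= b -> P a ->
  (forall t, a <= t <= b -> \forall s \near t & v \near t,
     a <= s -> s <= t -> t <= v -> v <= b -> P s -> P v) ->
  P b.
Proof.
move=> ab Pa step.
pose A := [set s | a <= s <= b /\ P s].
have Aa : A a by split => //; rewrite lexx ab.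
have Aub : ubound A b by move=> s [/andP[]].
have supA : has_sup A by split; [exists a | exists b].
set c := sup A.
have ac : a <= c by apply: ub_le_sup => //; exists b.
have cb : c <= b by apply: ge_sup => //; exists a.
have /step : a <= c <= b by rewrite ac cb.
move=> [[Q1 Q2]] /= [/nbhs_ballP[d1 d1p Qd1] /nbhs_ballP[d2 d2p Qd2]] Qs.
have d1p' : 0 < d1 by [].
have d2p' : 0 < d2 by [].
have [s [/andP[sa sb] Ps] cs] := sup_adherent d1p' supA.
have sc : s <= c by apply: ub_le_sup; [exists b | split => //; rewrite sa sb].
have stepv v : c <= v -> v < c + d2 -> v <= b -> P v.
  move=> cv vd vb; apply: (Qs (s, v)) => //=; split.
    by apply: Qd1; rewrite /ball/= ger0_norm ?subr_ge0// ltrBlDr -ltrBlDl.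
  by apply: Qd2; rewrite /ball/= distrC ger0_norm ?subr_ge0// ltrBlDl.
have [bd|db] := ltP b (c + d2 / 2).
  by apply: stepv => //; lra.
have : c + d2 / 2 <= c.
  apply: ub_le_sup; first by exists b.
  split; first by apply/andP; split; lra.
  by apply: stepv; lra.
lra.
Qed.

(* Off an open set [U] of small measure containing [N], the increments of [g] are controlled by the straddle bound; inside [U], by the absolute continuity of [u]. *)
Lemma straddle_ac_le (R : realType) (H : normedModType R) (a b K : R)
    (u : R -> H) (g : R -> R) (N : set R) :
  a <= b -> 0 <= K -> abs_cont_on a b u ->
  (forall s v, a <= s -> s <= v -> v <= b ->
     `|g v - g s| <= K * (`|u v - u s| + `|v - s|)) ->
  (@lebesgue_measure R).-negligible N ->
  (forall t, a <= t <= b -> ~ N t -> straddle_le g t 0) ->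
  g b <= g a.
Proof.
move=> ab K0 uac gdom Nneg gstr; apply/ler_addgt0Pr => e e0.
(* The final error is [e1 * (b - a)] from the points off [N], plus [K] times at most [e1] for the
   increments of [u] and at most [e1] for the lengths. *)
pose e1 := e / (b - a + 2 * K + 1).
have den0 : 0 < b - a + 2 * K + 1 by lra.
have e10 : 0 < e1 by rewrite divr_gt0.
have eE : e1 * (b - a + 2 * K + 1) = e by rewrite divfK ?gt_eqF.
have [del del0 uacP] := uac _ e10.
(* Half of [del], because the measure of the open set is bounded only by a non-strict inequality. *)
have m0 : 0 < Num.min (del / 2) e1 by rewrite lt_min; apply/andP; split; lra.
have [U [oU NU]] := outer_measure_open_le N m0.
rewrite (negligible_outer_measure N).1 // add0e => muU.
have mU : measurable U by exact: measurable_realfun.open_measurable.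
(* [P s] keeps a finite ordered family of intervals up to [s] that absorbs the passages through [N].
   Charging its length to the part of [U] in []a, s]] keeps the total below the measure of [U],
   however many intervals are added. *)
pose P s := s <= b -> exists (n : nat) (l r : nat -> R),
  [/\ forall k, (k < n)%N -> a <= l k /\ l k <= r k /\ r k <= s,
      forall k, (k.+1 < n)%N -> r k <= l k.+1,
      ((\sum_(k < n) (r k - l k))%:E <= lebesgue_measure (U `&` `]a, s]%classic))%E &
      g s - g a <= e1 * (s - a) +
        K * (\sum_(k < n) `|u (r k) - u (l k)| + \sum_(k < n) (r k - l k))].
have Pb : P b.
  apply: (@real_induction _ a b P ab).
    move=> _; exists 0%N, (fun=> 0), (fun=> 0); split=> //.
      by rewrite big_ord0 measure_ge0.
    by rewrite !big_ord0 !subrr !mulr0 addr0 mulr0 addr0.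
  move=> t tab; have [Nt|nNt] := pselect (N t); last first.
    apply: filterS (gstr _ tab nNt _ e10) => -[s v] /= gsv as_ st tv vb Ps _.
    have [//|n [l [r [lr rl mlr gs]]]] := Ps; first by lra.
    exists n, l, r; split => //.
    - by move=> k /lr [? [? ?]]; split => //; split => //; lra.
    - apply: (le_trans mlr); apply: le_measure; rewrite ?inE.
      + by apply: measurableI => //; exact: measurable_itv.
      + by apply: measurableI => //; exact: measurable_itv.
      + apply: setIS => y; rewrite /= !in_itv/= => /andP[-> ys]/=; lra.
    - have := gsv st tv; rewrite add0r; lra.
  (* At a point of [N] the interval from [s] to [v] lies in [U] and joins the family. Its length
     adds to the earlier ones because []s, v]] is disjoint from []a, s]]. *)
  have /nbhs_ballP[d d0 dU] : nbhs t U by apply: open_nbhs_nbhs; split => //; exact: NU.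
  exists (ball t d, ball t d) => [|[s v] [/= ts tv] as_ st tv' vb Ps _].
    by split; exact: nbhsx_ballx.
  have [//|n [l [r [lr rl mlr gs]]]] := Ps; first by lra.
  have sv : s <= v := le_trans st tv'.
  exists n.+1, (fun k => if k == n then s else l k),
    (fun k => if k == n then v else r k).
  have sumE (F : R -> R -> R) :
      \sum_(k < n.+1) F (if k == n :> nat then s else l k)
                        (if k == n :> nat then v else r k) =
      \sum_(k < n) F (l k) (r k) + F s v.
    rewrite big_ord_recr/= eqxx; congr (_ + _).
    by apply: eq_bigr => i _; rewrite ltn_eqF.
  split.
  - move=> k; rewrite ltnS leq_eqVlt => /orP[/eqP ->|kn]; first by rewrite eqxx.
    rewrite ltn_eqF//; have [? [? ?]] := lr _ kn.
    by split => //; split => //; lra.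
  - move=> k; rewrite ltnS => kn; rewrite (ltn_eqF kn).
    have [kn'|kn'] := eqVneq k.+1 n; first by have [_ []] := lr _ kn.
    by apply: rl; rewrite ltn_neqAle kn' kn.
  - rewrite (sumE (fun x y => y - x)) EFinD.
    have -> : ((v - s)%:E = lebesgue_measure (`]s, v]%classic : set R))%E.
      by rewrite lebesgue_measure_itv/= lte_fin; case: ltgtP sv => // -> _; rewrite subrr.
    apply: (@le_trans _ _ (lebesgue_measure ((U `&` `]a, s]) `|` `]s, v]%classic))).
      rewrite measureU//; [|exact: measurableI|].
        by rewrite leeD2r.
      apply/seteqP; split => // y [[_]] /=; rewrite !in_itv/= => /andP[_ ys] /andP[sy _].
      by move: (lt_le_trans sy ys); rewrite ltxx.
    apply: le_measure; rewrite ?inE; [|exact: measurableI|].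
      by apply: measurableU => //; exact: measurableI.
    move=> y [[Uy]|]; rewrite /= !in_itv/= => /andP[h1 h2]; split => //.
    + by rewrite h1 (le_trans h2 sv).
    + apply: dU; move: ts tv; rewrite /ball/= !ltr_distl => /andP[? ?] /andP[? ?].
      by apply/andP; split; lra.
    + by rewrite h2 (le_lt_trans as_ h1).
  - rewrite (sumE (fun x y => y - x)) (sumE (fun x y => `|u y - u x|)).
    have := gdom _ _ as_ sv vb; rewrite (ger0_norm (_ : 0 <= v - s)) ?subr_ge0//.
    have := ler_norm (g v - g s).
    have : 0 <= e1 * (v - s) by rewrite mulr_ge0 ?subr_ge0// ltW.
    rewrite !mulrBr !mulrDr; lra.
have [//|n [l [r [lr rl mlr gs]]]] := Pb.
have Slt : \sum_(k < n) (r k - l k) <= Num.min (del / 2) e1.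
  rewrite -lee_fin; apply: (le_trans mlr); apply: le_trans muU.
  by apply: le_measure; rewrite ?inE//; exact: measurableI.
have S1 : \sum_(k < n) (r k - l k) < del.
  by apply: (le_lt_trans Slt); rewrite gt_min; apply/orP; left; lra.
have S2 : \sum_(k < n) (r k - l k) <= e1.
  by apply: (le_trans Slt); rewrite ge_min lexx orbT.
have S3 := uacP _ _ _ lr rl S1.
have : K * (\sum_(k < n) `|u (r k) - u (l k)| + \sum_(k < n) (r k - l k)) <=
   K * (2 * e1) by apply: ler_wpM2l => //; lra.
lra.
Qed.

Lemma abs_cont_onS (R : realType) (H : normedModType R) (u : R -> H) (a b c d : R) :
  a <= c -> d <= b -> abs_cont_on a b u -> abs_cont_on c d u.
Proof.
move=> ac db uac e e0; have [del del0 P] := uac _ e0; exists del => // n l r lr rl.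
apply: P => // k /lr[? [? ?]]; split; first exact: le_trans ac _.
by split => //; exact: le_trans db.
Qed.

(** Each point has its own domination constant, so [straddle_ac_le] is applied on short intervals
    and a second real induction glues the results. *)
Lemma straddle_dominated_le (R : realType) (H : normedModType R) (a b : R)
    (u : R -> H) (g : R -> R) (N : set R) :
  a <= b -> abs_cont_on a b u ->
  (forall t, a <= t <= b -> dominated_near u g t) ->
  (@lebesgue_measure R).-negligible N ->
  (forall t, a <= t <= b -> ~ N t -> straddle_le g t 0) ->
  g b <= g a.
Proof.
move=> ab uac gdom Nneg gstr.
apply: (@real_induction _ a b (fun s => g s <= g a)) => // t tab.
have [K K0 [[A B] /= [/nbhs_ballP[d1 d1p dA] /nbhs_ballP[d2 d2p dB]] AB]] := gdom _ tab.
have d0 : 0 < Num.min d1 d2 by rewrite lt_min; apply/andP; split.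
pose d := Num.min d1 d2.
exists (ball t d, ball t d) => [|[s v] [/= ts tv] as_ st tv' vb gs].
  by split; exact: nbhsx_ballx.
apply: le_trans gs; apply: (@straddle_ac_le _ _ s v K u g N) => //.
- exact: le_trans tv'.
- exact: abs_cont_onS uac.
- move=> s' v' ss' sv' vv'.
  have inb w : s <= w -> w <= v -> ball t d w.
    move: ts tv; rewrite /ball/= !ltr_distl => /andP[? ?] /andP[? ?] ? ?.
    by apply/andP; split; lra.
  apply: (AB (s', v')); split => /=.
    apply: dA; apply: (@le_ball _ _ _ d); first by rewrite ge_min lexx.
    by apply: inb => //; exact: le_trans vv'.
  apply: dB; apply: (@le_ball _ _ _ d); first by rewrite ge_min lexx orbT.
  by apply: inb => //; exact: le_trans sv'.
- by move=> w /andP[sw wv]; apply: gstr; rewrite (le_trans as_ sw) (le_trans wv vb).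
Qed.

(** The quotient-free form has no excluded point [v = t], so remainders can be added and estimated
    directly in the product and chain rules. *)
Lemma is_derive_nearP (R : realType) (V : normedModType R) (g : R -> V) (t : R) (d : V) :
  is_derive t 1 g d <->
  forall e, 0 < e -> \forall v \near t, `|g v - g t - (v - t) *: d| <= e * `|v - t|.
Proof.
have shiftE : (fun h : R => h^-1 *: ((g \o shift t) (h *: (1 : R)) - g t)) =
    fun h : R => h^-1 *: (g (h + t) - g t).
  by apply/funext => h /=; rewrite scaler1.
have quotE (h : R) : h != 0 ->
    `|g (h + t) - g t - h *: d| = `|h| * `|d - h^-1 *: (g (h + t) - g t)|.
  by move=> h0; rewrite -normrZ scalerBr scalerA divff// scale1r distrC.
split=> [gd e e0|gd].
  have : h^-1 *: (g (h + t) - g t) @[h --> (0 : R)^'] --> d.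
    have := @ex_derive _ _ _ _ _ _ _ gd; rewrite /derivable shiftE => /cvgP.
    by have := @derive_val _ _ _ _ _ _ _ gd; rewrite /derive shiftE => ->.
  move=> /cvgrPdist_le /(_ _ e0); rewrite near_withinE => /nbhs_ballP[del del0 D].
  apply/nbhs_ballP; exists del => // v tv.
  have [->|vt] := eqVneq v t; first by rewrite !subrr scale0r subrr !normr0 mulr0.
  have vt0 : v - t != 0 by rewrite subr_eq0.
  have /D : ball 0 del (v - t) by move: tv; rewrite /ball/= sub0r opprB.
  move=> /(_ vt0) /=; rewrite subrK => vle; have := quotE _ vt0; rewrite subrK => ->.
  by rewrite mulrC ler_wpM2r.
suff cv : h^-1 *: (g (h + t) - g t) @[h --> (0 : R)^'] --> d.
  apply: DeriveDef; first by rewrite /derivable shiftE; apply/cvg_ex; exists d.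
  by rewrite /derive shiftE; apply: cvg_lim.
apply/cvgrPdist_le => e e0; rewrite near_withinE.
have /nbhs_ballP[del del0 D] := gd _ e0.
apply/nbhs_ballP; exists del => // h th h0 /=.
have /D : ball t del (h + t).
  by move: th; rewrite /ball/= sub0r opprD addrCA subrr addr0.
rewrite addrK quotE// mulrC ler_pM2r ?normr_gt0//.
Qed.

Lemma is_derive_continuous (R : realType) (V : normedModType R) (g : R -> V) (t : R) (d : V) :
  is_derive t 1 g d -> {for t, continuous g}.
Proof.
by move=> gd; apply: differentiable_continuous; apply/derivable1_diffP; exact: ex_derive.
Qed.

Lemma near_le_bound (R : realType) (V : normedModType R) (g : R -> V) (t : R) :
  {for t, continuous g} -> \forall s \near t, `|g s| <= `|g t| + 1.
Proof.
move=> /cvgrPdist_le /(_ _ ltr01); apply: filterS => s.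
rewrite distrC => h; rewrite -lerBlDl; apply: le_trans h; exact: lerB_dist.
Qed.

(** * Finite minima and maxima *)

Section FiniteMin.
Variables (R : realType) (m : nat).
Implicit Types g h : 'I_m.+1 -> R.

Lemma minI_le g i : minI g <= g i.
Proof. exact: bigmin_le. Qed.

Lemma minI_ge g c : (forall i, c <= g i) -> c <= minI g.
Proof. by move=> gc; apply/bigmin_geP. Qed.

Lemma minI_attained g : exists i, minI g = g i.
Proof.
have /bigmin_leP[h|[i _ h]] := lexx (minI g).
  by exists ord0; apply/eqP; rewrite eq_le h minI_le.
by exists i; apply/eqP; rewrite eq_le h minI_le.
Qed.

Lemma maxI_ge g i : g i <= maxI g.
Proof. exact: le_bigmax. Qed.

Lemma maxI_le g c : (forall i, g i <= c) -> maxI g <= c.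
Proof. by move=> gc; apply/bigmax_leP. Qed.

(** Links the minima in the merit functions with the maxima whose minimizer is [z(t)]. *)
Lemma minI_oppmax g h : minI (fun i => g i - h i) = - maxI (fun i => h i - g i).
Proof.
apply/eqP; rewrite eq_le; apply/andP; split.
  by rewrite lerNr; apply: maxI_le => i; rewrite lerNr opprB; exact: minI_le.
by apply: minI_ge => i; rewrite lerNl opprB; exact: maxI_ge.
Qed.

End FiniteMin.

(** * Calculus of straddle bounds *)

Section Straddle.
Variable R : realType.
Implicit Types (g h : R -> R) (t c d : R).

Lemma straddle_leW g t c d : c <= d -> straddle_le g t c -> straddle_le g t d.
Proof.
move=> cd gc e e0; apply: filterS (gc _ e0) => -[s v] /= gs st tv.
apply: le_trans (gs st tv) _; apply: ler_wpM2r; last by lra.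
by rewrite subr_ge0 (le_trans st tv).
Qed.

Lemma straddle_leD g h t c d :
  straddle_le g t c -> straddle_le h t d -> straddle_le (fun s => g s + h s) t (c + d).
Proof.
move=> gc hd e e0; have e2 : 0 < e / 2 by lra.
apply: filterS2 (gc _ e2) (hd _ e2) => -[s v] /= gs hs st tv.
by have := gs st tv; have := hs st tv; lra.
Qed.

Lemma is_derive_straddle_le g t d : is_derive t 1 g d -> straddle_le g t d.
Proof.
move=> /is_derive_nearP gd e e0; have /gd := e0.
move=> /nbhs_ballP[del del0 D]; exists (ball t del, ball t del) => [|[s v] [/= /D ds /D dv] st tv].
  by split; exact: nbhsx_ballx.
move: ds dv; rewrite /GRing.scale/= (ger0_norm (_ : 0 <= v - t)) ?subr_ge0//.
rewrite (ler0_norm (_ : s - t <= 0)) ?subr_le0// !ler_norml => /andP[? ?] /andP[? ?].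
lra.
Qed.

(** The index attaining the minimum at the left endpoint [s] also bounds the minimum at [v] from
    above, and finitely many indices share one neighbourhood. *)
Lemma straddle_le_minI (m : nat) (F : 'I_m.+1 -> R -> R) t c :
  (forall i, straddle_le (F i) t c) -> straddle_le (fun s => minI (F ^~ s)) t c.
Proof.
move=> Fc e e0.
have : \forall s \near t & v \near t, forall i, s <= t -> t <= v ->
    F i v - F i s <= (c + e) * (v - s).
  exact: (@filter_forall _ _ (fun i (p : R * R) => p.1 <= t -> t <= p.2 ->
    F i p.2 - F i p.1 <= (c + e) * (p.2 - p.1)) _ _ (fun i => Fc i e e0)).
apply: filterS => -[s v] /= Fs st tv.
have [i ->] := minI_attained (F ^~ s).
by apply: le_trans (Fs i st tv); rewrite lerD2r; exact: (minI_le (F ^~ v)).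
Qed.

(** Positivity of [a t] preserves the one-sided bound on [g]; continuity of [g] allows [g s] to be
    replaced by [g t] in the term carrying the derivative of [a]. *)
Lemma straddle_leM (a g : R -> R) t da c :
  is_derive t 1 a da -> 0 < a t -> {for t, continuous g} -> straddle_le g t c ->
  straddle_le (fun s => a s * g s) t (da * g t + a t * c).
Proof.
move=> ad at0 gcont gc e e0.
(* Four errors of [e / 4] each: the slack [e1] in the slope of [g], the variation of [a] in [near1],
   the continuity of [g] through [e2], and the differentiability of [a] through [e3]. *)
pose e1 := e / (4 * a t); have e10 : 0 < e1 by rewrite divr_gt0// mulr_gt0.
have e1E : a t * e1 = e / 4 by rewrite /e1; field; rewrite gt_eqF.
pose C := `|da| + 1; have C0 : 0 < C by rewrite ltr_wpDl.
pose e2 := e / (4 * C); have e20 : 0 < e2 by rewrite divr_gt0// mulr_gt0.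
have e2E : e2 * C = e / 4 by rewrite /e2; field; rewrite gt_eqF.
pose D := `|g t| + 1; have D0 : 0 < D by rewrite ltr_wpDl.
pose e3 := Num.min 1 (e / (4 * D)).
have e30 : 0 < e3 by rewrite lt_min ltr01 divr_gt0// mulr_gt0.
have e3E : D * e3 <= e / 4.
  have -> : e / 4 = D * (e / (4 * D)) by field; rewrite gt_eqF.
  by rewrite ler_pM2l// ge_min lexx orbT.
have e3le1 : e3 <= 1 by rewrite ge_min lexx.
have acont := is_derive_continuous ad.
have near1 : \forall v \near t, a v * (c + e1) <= a t * (c + e1) + e / 4 /\ 0 <= a v.
  have e40 : 0 < Num.min (a t) (e / 4 / (`|c + e1| + 1)).
    by rewrite lt_min at0 divr_gt0 ?ltr_wpDl//; lra.
  move/cvgrPdist_le: (acont) => /(_ _ e40); apply: filterS => v.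
  rewrite le_min => /andP[h1 h2]; split; last first.
    by move: h1; rewrite ler_norml => /andP[_]; lra.
  rewrite -lerBlDl -mulrBl; apply: le_trans (ler_norm _) _.
  rewrite normrM distrC; apply: (@le_trans _ _ (`|a t - a v| * (`|c + e1| + 1))).
    by apply: ler_wpM2l => //; lra.
  by rewrite -ler_pdivlMr// ltr_wpDl.
have near2 : \forall s \near t, `|g t - g s| <= e2.
  by move/cvgrPdist_le: gcont => /(_ _ e20).
have near3 := (is_derive_nearP _ _ _).1 ad _ e30.
have : \forall s \near t & v \near t, [/\ a v * (c + e1) <= a t * (c + e1) + e / 4, 0 <= a v,
    `|g t - g s| <= e2, `|a v - a t - (v - t) *: da| <= e3 * `|v - t| &
    `|a s - a t - (s - t) *: da| <= e3 * `|s - t|].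
  exists ([set s | `|g t - g s| <= e2] `&` [set s | `|a s - a t - (s - t) *: da| <= e3 * `|s - t|],
    [set v | a v * (c + e1) <= a t * (c + e1) + e / 4 /\ 0 <= a v] `&`
    [set v | `|a v - a t - (v - t) *: da| <= e3 * `|v - t|]) => [|[s v] [/= [? ?] [[? ?] ?]]] //.
  by split; apply: filterI.
apply: filterS2 (gc _ e10) => -[s v] /= gs [av av0 gts adv ads] st tv.
have {}gs := gs st tv.
have vs0 : 0 <= v - s by rewrite subr_ge0 (le_trans st tv).
move: adv ads; rewrite (ger0_norm (_ : 0 <= v - t)) ?subr_ge0//.
rewrite (ler0_norm (_ : s - t <= 0)) ?subr_le0// /GRing.scale/= => adv ads.
have aerr : `|a v - a s - (v - s) * da| <= e3 * (v - s).
  have -> : a v - a s - (v - s) * da =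
    (a v - a t - (v - t) * da) - (a s - a t - (s - t) * da) by ring.
  apply: le_trans (ler_normB _ _) _; lra.
have alip : `|a v - a s| <= C * (v - s).
  have -> : a v - a s = (a v - a s - (v - s) * da) + (v - s) * da by ring.
  apply: le_trans (ler_normD _ _) _; rewrite normrM (ger0_norm vs0) /C.
  have : e3 * (v - s) <= 1 * (v - s) by rewrite ler_wpM2r.
  lra.
have t1 : a v * (g v - g s) <= (a t * (c + e1) + e / 4) * (v - s).
  apply: (@le_trans _ _ (a v * (c + e1) * (v - s))); last by rewrite ler_wpM2r.
  by rewrite -mulrA ler_wpM2l.
have t2 : (g s - g t) * (a v - a s) <= e / 4 * (v - s).
  apply: le_trans (ler_norm _) _; rewrite normrM distrC.
  by rewrite -e2E -mulrA ler_pM.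
have t3 : g t * (a v - a s - (v - s) * da) <= e / 4 * (v - s).
  apply: le_trans (ler_norm _) _; rewrite normrM.
  apply: (@le_trans _ _ (D * (e3 * (v - s)))); first by rewrite ler_pM// /D; lra.
  by rewrite mulrA ler_wpM2r.
have -> : a v * g v - a s * g s = a v * (g v - g s) + (g s - g t) * (a v - a s) +
  g t * (a v - a s - (v - s) * da) + g t * da * (v - s) by ring.
rewrite (mulrDr (a t)) e1E in t1.
lra.
Qed.

End Straddle.

Lemma nearW2 (T : topologicalType) (t : T) (P : T -> T -> Prop) :
  (forall s v, P s v) -> \forall s \near t & v \near t, P s v.
Proof. by move=> h; exists (setT, setT) => //=; split; exact: filterT. Qed.

(** * Calculus of domination *)

Section Domination.
Variables (R : realType) (H : normedModType R) (u : R -> H).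

Lemma dominated_self t : dominated_near u u t.
Proof.
exists 1 => //; apply: nearW2 => s v.
by rewrite mul1r lerDl.
Qed.

Lemma dominated_lipschitz (V : normedModType R) (g : R -> V) t K : 0 <= K ->
  (\forall s \near t & v \near t, `|g v - g s| <= K * `|v - s|) -> dominated_near u g t.
Proof.
move=> K0 gK; exists K => //; apply: filterS gK => -[s v] /= /le_trans; apply.
by rewrite ler_wpM2l// lerDr.
Qed.

Lemma dominated_comp2 (V1 V2 V : normedModType R) (g1 : R -> V1) (g2 : R -> V2) (g : R -> V) t C :
  0 <= C -> dominated_near u g1 t -> dominated_near u g2 t ->
  (\forall s \near t & v \near t, `|g v - g s| <= C * (`|g1 v - g1 s| + `|g2 v - g2 s|)) ->
  dominated_near u g t.
Proof.
move=> C0 [K1 K10 h1] [K2 K20 h2] h; exists (C * (K1 + K2)).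
  by rewrite mulr_ge0// addr_ge0.
apply: filterS2 h (filterI h1 h2) => -[s v] /= gsv [g1sv g2sv]; apply: (le_trans gsv).
by rewrite -mulrA ler_wpM2l// mulrDl lerD.
Qed.

Lemma dominatedD (V : normedModType R) (g h : R -> V) t :
  dominated_near u g t -> dominated_near u h t ->
  dominated_near u (fun s => g s + h s) t.
Proof.
move=> gd hd; apply: (dominated_comp2 ler01 gd hd); apply: nearW2 => s v.
rewrite mul1r opprD addrACA; exact: ler_normD.
Qed.

Lemma dominated_continuous (V : normedModType R) (g : R -> V) t :
  {for t, continuous u} -> dominated_near u g t -> {for t, continuous g}.
Proof.
move=> uc [K K0 [[A B] /= [tA tB] AB]]; apply/cvgrPdist_le => e e0.
pose e1 := e / (2 * (K + 1)).
have e10 : 0 < e1 by rewrite divr_gt0// mulr_gt0// ltr_wpDl.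
have e1E : (K + 1) * (e1 + e1) = e by rewrite /e1; field; rewrite gt_eqF// ltr_wpDl.
have nA := nbhs_singleton tA.
have n1 : \forall v \near t, `|u t - u v| <= e1 by move/cvgrPdist_le: uc => /(_ _ e10).
have n2 : \forall v \near t, `|t - v| <= e1.
  by apply/nbhs_ballP; exists e1 => // v; rewrite /ball/= => /ltW.
apply: filterS3 tB n1 n2 => v Bv uv tv.
rewrite distrC -e1E; apply: le_trans (AB (t, v) _) _ => //=.
rewrite (distrC (u v)) (distrC v); apply: ler_pM; rewrite ?addr_ge0//.
  by rewrite lerDl.
exact: lerD.
Qed.

Lemma dominatedM (g h : R -> R) t : {for t, continuous u} ->
  dominated_near u g t -> dominated_near u h t ->
  dominated_near u (fun s => g s * h s) t.
Proof.
move=> uc gd hd.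
have gb := near_le_bound (dominated_continuous uc gd).
have hb := near_le_bound (dominated_continuous uc hd).
have C0 : 0 <= (`|g t| + 1) + (`|h t| + 1) by rewrite !addr_ge0.
apply: (dominated_comp2 C0 gd hd).
exists ([set s | `|h s| <= `|h t| + 1], [set v | `|g v| <= `|g t| + 1]) => //.
move=> [s v] [/= hs gv].
have -> : g v * h v - g s * h s = g v * (h v - h s) + h s * (g v - g s) by ring.
apply: le_trans (ler_normD _ _) _; rewrite !normrM mulrDr addrC.
by apply: lerD; apply: ler_wpM2r => //; [apply: (le_trans hs)|apply: (le_trans gv)];
  rewrite ?lerDr ?lerDl addr_ge0.
Qed.

Lemma dominated_minI (m : nat) (F : 'I_m.+1 -> R -> R) t :
  (forall i, dominated_near u (F i) t) -> dominated_near u (fun s => minI (F ^~ s)) t.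
Proof.
move=> Fd.
have /choice[K HK] : forall i, exists K, 0 <= K /\ \forall s \near t & v \near t,
    `|F i v - F i s| <= K * (`|u v - u s| + `|v - s|).
  by move=> i; have [K ? ?] := Fd i; exists K.
(* The sum serves as a constant common to all indices, because the minima at [s] and [v] may be
   attained at different ones. *)
exists (\sum_i K i); first by apply: sumr_ge0 => i _; have [] := HK i.
have : \forall s \near t & v \near t, forall i,
    `|F i v - F i s| <= K i * (`|u v - u s| + `|v - s|).
  exact: (@filter_forall _ _ (fun i (p : R * R) => `|F i p.2 - F i p.1| <=
    K i * (`|u p.2 - u p.1| + `|p.2 - p.1|)) _ _ (fun i => (HK i).2)).
apply: filterS => -[s v] /= h.
have h1 i : `|F i v - F i s| <= (\sum_i K i) * (`|u v - u s| + `|v - s|).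
  apply: (le_trans (h i)); apply: ler_wpM2r; first by rewrite addr_ge0.
  rewrite (bigD1 i)//= lerDl; apply: sumr_ge0 => j _; have [] := HK j => //.
have [i iE] := minI_attained (F ^~ s); have [j jE] := minI_attained (F ^~ v).
rewrite ler_norml; apply/andP; split.
  rewrite jE; apply: (@le_trans _ _ (F j v - F j s)).
    by have := h1 j; rewrite ler_norml => /andP[].
  by rewrite lerD2l lerN2; exact: (minI_le (F ^~ s)).
rewrite iE; apply: (@le_trans _ _ (F i v - F i s)).
  by rewrite lerD2r; exact: (minI_le (F ^~ v)).
by have := h1 i; rewrite ler_norml => /andP[].
Qed.

End Domination.

(** * Inner products, gradients and chain rules *)

Section InnerProduct.
Variables (R : realType) (H : normedModType R) (ip : H -> H -> R).
Hypothesis hip : inner_product ip.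

Lemma ipC x y : ip x y = ip y x. Proof. by have [h _] := hip. Qed.

Lemma ipxx x : ip x x = `|x| ^+ 2. Proof. by have [_ [_ h]] := hip. Qed.

Lemma ipDl x y z : ip (x + y) z = ip x z + ip y z.
Proof. by have [_ [h _]] := hip; have := h 1 x y z; rewrite scale1r mul1r. Qed.

Lemma ip0l z : ip 0 z = 0.
Proof. by have := ipDl 0 0 z; rewrite addr0; lra. Qed.

Lemma ipZl a x z : ip (a *: x) z = a * ip x z.
Proof. by have [_ [h _]] := hip; have := h a x 0 z; rewrite addr0 ip0l addr0. Qed.

Lemma ipNl x z : ip (- x) z = - ip x z.
Proof. by rewrite -scaleN1r ipZl mulN1r. Qed.

Lemma ipBl x y z : ip (x - y) z = ip x z - ip y z.
Proof. by rewrite ipDl ipNl. Qed.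

Lemma ipDr x y z : ip z (x + y) = ip z x + ip z y.
Proof. by rewrite ipC ipDl !(ipC z). Qed.

Lemma ipZr a x z : ip z (a *: x) = a * ip z x.
Proof. by rewrite ipC ipZl (ipC z). Qed.

Lemma ipNr x z : ip z (- x) = - ip z x.
Proof. by rewrite ipC ipNl (ipC z). Qed.

Lemma ipBr x y z : ip z (x - y) = ip z x - ip z y.
Proof. by rewrite ipDr ipNr. Qed.

Lemma ip_suml (I : finType) (c : I -> R) (F : I -> H) z :
  ip (\sum_i c i *: F i) z = \sum_i c i * ip (F i) z.
Proof.
rewrite (big_morph (ip^~ z) (fun a b => ipDl a b z) (ip0l z)).
by apply: eq_bigr => i _; rewrite ipZl.
Qed.

Lemma normD2 x y : `|x + y| ^+ 2 = `|x| ^+ 2 + 2 * ip x y + `|y| ^+ 2.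
Proof. by rewrite -!ipxx !ipDl !ipDr (ipC y x); ring. Qed.

Lemma normB2 x y : `|x - y| ^+ 2 = `|x| ^+ 2 - 2 * ip x y + `|y| ^+ 2.
Proof. by rewrite normD2 ipNr normrN; ring. Qed.

Lemma ip_cauchy x y : `|ip x y| <= `|x| * `|y|.
Proof.
have [->|y0] := eqVneq y 0; first by rewrite ipC ip0l !normr0 mulr0.
rewrite -(ler_pXn2r (n := 2))// ?nnegrE ?mulr_ge0//.
have yp : 0 < `|y| ^+ 2 by rewrite exprn_gt0// normr_gt0.
have : 0 <= `| `|y| ^+ 2 *: x - ip x y *: y | ^+ 2 by rewrite exprn_ge0.
rewrite normB2 !normrZ ipZl ipZr => h.
have : 0 <= `|y| ^+ 2 * (`|x| ^+ 2 * `|y| ^+ 2 - `|ip x y| ^+ 2).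
  apply: le_trans h _; rewrite !exprMn !real_normK ?num_real//.
  by rewrite le_eqVlt; apply/orP; left; apply/eqP; ring.
by rewrite pmulr_rge0// subr_ge0 exprMn.
Qed.

Lemma ip_le x y : ip x y <= `|x| * `|y|.
Proof. exact: le_trans (ler_norm _) (ip_cauchy _ _). Qed.

Lemma is_derive_ip (v w : R -> H) (t : R) (dv dw : H) :
  is_derive t 1 v dv -> is_derive t 1 w dw ->
  is_derive t 1 (fun s => ip (v s) (w s)) (ip dv (w t) + ip (v t) dw).
Proof.
move=> vd wd; apply/is_derive_nearP => e e0.
pose C := (`|w t| + 1) + (`|dv| + 1) + (`|v t| + 1).
have C0 : 0 < C by rewrite /C !ltr_wpDl ?addr_ge0.
pose e1 := e / C; have e10 : 0 < e1 by rewrite divr_gt0.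
have e1E : e1 * C = e by rewrite divfK ?gt_eqF.
have n1 := (is_derive_nearP _ _ _).1 vd _ e10.
have n2 := (is_derive_nearP _ _ _).1 wd _ e10.
have wc := is_derive_continuous wd.
have n3 := near_le_bound wc.
have n4 : \forall s \near t, `|w s - w t| <= e1.
  by move/cvgrPdist_le: wc => /(_ _ e10); apply: filterS => s; rewrite distrC.
apply: filterS2 (filterI n1 n2) (filterI n3 n4) => s [h1 h2] [h3 h4].
rewrite /GRing.scale/=.
have -> : ip (v s) (w s) - ip (v t) (w t) - (s - t) * (ip dv (w t) + ip (v t) dw) =
    ip (v s - v t - (s - t) *: dv) (w s) + (s - t) * ip dv (w s - w t) +
    ip (v t) (w s - w t - (s - t) *: dw).
  by rewrite !(ipBl, ipBr, ipZl, ipZr); ring.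
apply: le_trans (ler_normD _ _) _; apply: le_trans (lerD (ler_normD _ _) (lexx _)) _.
rewrite normrM -e1E.
have p1 : `|ip (v s - v t - (s - t) *: dv) (w s)| <= e1 * `|s - t| * (`|w t| + 1).
  by apply: le_trans (ip_cauchy _ _) _; apply: ler_pM.
have p2 : `|s - t| * `|ip dv (w s - w t)| <= `|s - t| * ((`|dv| + 1) * e1).
  apply: ler_wpM2l => //; apply: le_trans (ip_cauchy _ _) _; apply: ler_pM => //.
  by rewrite lerDl.
have p3 : `|ip (v t) (w s - w t - (s - t) *: dw)| <= (`|v t| + 1) * (e1 * `|s - t|).
  by apply: le_trans (ip_cauchy _ _) _; apply: ler_pM => //; rewrite lerDl.
rewrite /C; lra.
Qed.

Lemma is_derive_gradient (g : H -> R) (x : R -> H) (t : R) (d dx : H) :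
  has_gradient ip g (x t) d -> is_derive t 1 x dx ->
  is_derive t 1 (g \o x) (ip d dx).
Proof.
move=> gd xd; apply/is_derive_nearP => e e0.
pose C := (`|d| + 1) + (`|dx| + 1).
have C0 : 0 < C by rewrite /C !ltr_wpDl ?addr_ge0.
pose e1 := Num.min 1 (e / C).
have e10 : 0 < e1 by rewrite lt_min ltr01 divr_gt0.
have e1E : e1 * C <= e by rewrite -ler_pdivlMr// ge_min lexx orbT.
have e1le : e1 <= 1 by rewrite ge_min lexx.
have n1 := (is_derive_nearP _ _ _).1 xd _ e10.
have [del del0 D] := gd _ e10.
have n2 : \forall s \near t, `|x s - x t| < del.
  have /cvgrPdist_lt /(_ _ del0) := is_derive_continuous xd.
  by apply: filterS => s; rewrite distrC.
apply: filterS2 n1 n2 => s h1 /D; rewrite (addrC (x t)) subrK => h2 /=.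
rewrite /GRing.scale/=.
have -> : g (x s) - g (x t) - (s - t) * ip d dx =
    (g (x s) - g (x t) - ip d (x s - x t)) + ip d (x s - x t - (s - t) *: dx).
  by rewrite !(ipBl, ipBr, ipZl, ipZr); ring.
apply: le_trans (ler_normD _ _) _.
have p1 : `|x s - x t| <= (`|dx| + 1) * `|s - t|.
  have -> : x s - x t = (x s - x t - (s - t) *: dx) + (s - t) *: dx by rewrite subrK.
  apply: le_trans (ler_normD _ _) _; rewrite normrZ.
  have : e1 * `|s - t| <= 1 * `|s - t| by rewrite ler_wpM2r.
  lra.
have p2 : e1 * `|x s - x t| <= e1 * ((`|dx| + 1) * `|s - t|).
  by rewrite ler_wpM2l// ltW.
have p3 : `|ip d (x s - x t - (s - t) *: dx)| <= (`|d| + 1) * (e1 * `|s - t|).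
  by apply: le_trans (ip_cauchy _ _) _; apply: ler_pM => //; rewrite lerDl.
have p4 : e1 * C * `|s - t| <= e * `|s - t| by rewrite ler_wpM2r.
rewrite /C in p4; lra.
Qed.

(** The scalar mean value theorem is applied to the component of [x] along its own increment [e];
    dividing by the norm of [e] gives the vector estimate. *)
Lemma is_derive_lipschitz_near (x xd : R -> H) (t : R) :
  (\forall s \near t, is_derive (s : R) 1 x (xd s)) -> {for t, continuous xd} ->
  \forall s \near t & v \near t, `|x v - x s| <= (`|xd t| + 1) * `|v - s|.
Proof.
move=> xder /near_le_bound xdb; set K := `|xd t| + 1.
have : \forall s \near t, is_derive (s : R) 1 x (xd s) /\ `|xd s| <= K by exact: filterI.
move=> /nbhs_ballP[del del0 D].
exists (ball t del, ball t del) => [|[s v] [/= ts tv]].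
  by split; exact: nbhsx_ballx.
wlog sv : s v ts tv / s <= v.
  move=> W; have [sv|/ltW vs] := leP s v; first exact: W.
  by rewrite distrC (distrC v); exact: W.
have inb w : s <= w <= v -> ball t del w.
  move: ts tv; rewrite /ball/= !ltr_distl => /andP[? ?] /andP[? ?] /andP[? ?].
  by apply/andP; split; lra.
set e := x v - x s.
have phid w : s <= w <= v -> is_derive w 1 (fun w => ip (x w) e) (ip (xd w) e).
  move=> /inb/D[xw _]; have := is_derive_ip xw (is_derive_cst e w 1).
  by rewrite [ip (x w) 0]ipC ip0l addr0.
have [||c cE phiE] := @MVT_segment R (fun w => ip (x w) e) (fun w => ip (xd w) e) s v sv.
- by move=> w; rewrite in_itv/= => /andP[/ltW sw /ltW wv]; apply: phid; rewrite sw wv.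
- apply: derivable_within_continuous => w; rewrite in_itv/= => /phid ?.
  exact: ex_derive.
have [e0|e0] := eqVneq e 0.
  by rewrite e0 normr0 mulr_ge0// addr_ge0.
have ep : 0 < `|e| by rewrite normr_gt0.
rewrite -(ler_pM2r ep) -expr2 -ipxx {1}/e ipBl phiE (ger0_norm (_ : 0 <= v - s)) ?subr_ge0//.
rewrite mulrAC; apply: ler_wpM2r; first by rewrite subr_ge0.
apply: le_trans (ip_le _ _) _; apply: ler_wpM2r => //.
by move: cE; rewrite in_itv/= => /inb/D[].
Qed.

Lemma convex_gradient_le (g : H -> R) (x y d : H) :
  convex_fun g -> has_gradient ip g x d -> g x + ip d (y - x) <= g y.
Proof.
move=> gc gd; apply/ler_addgt0Pr => e e0.
pose N := `|y - x| + 1; have N0 : 0 < N by rewrite ltr_wpDl.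
pose e1 := e / N; have e10 : 0 < e1 by rewrite divr_gt0.
have e1E : e1 * N = e by rewrite divfK ?gt_eqF.
have [del del0 D] := gd _ e10.
(* Short enough for [s *: (y - x)] to stay within the radius of the gradient estimate; convexity at
   parameter [s] is then divided by [s]. *)
pose s := Num.min 1 (del / (2 * N)).
have s0 : 0 < s by rewrite lt_min ltr01 divr_gt0// mulr_gt0.
have s1 : s <= 1 by rewrite ge_min lexx.
have sN : s * N <= del / 2.
  apply: (@le_trans _ _ (del / (2 * N) * N)).
    by rewrite ler_wpM2r ?(ltW N0)// ge_min lexx orbT.
  by rewrite le_eqVlt; apply/orP; left; apply/eqP; field; rewrite gt_eqF.
have sd : `|s *: (y - x)| <= s * N.
  by rewrite normrZ (ger0_norm (ltW s0)) ler_wpM2l ?(ltW s0)// lerDl.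
have /D : `|s *: (y - x)| < del by lra.
have -> : x + s *: (y - x) = s *: y + (1 - s) *: x.
  by rewrite scalerBr scalerBl scale1r addrCA.
rewrite ipZr => h.
have := gc y x s; rewrite (ltW s0) s1 => /(_ isT) h2.
have : s * (g x + ip d (y - x)) <= s * (g y + e).
  move: h; rewrite ler_norml => /andP[h _].
  have : e1 * `|s *: (y - x)| <= e1 * (s * N) by rewrite ler_wpM2l// ltW.
  have -> : e1 * (s * N) = s * e by rewrite -e1E; ring.
  lra.
by rewrite ler_pM2l.
Qed.

End InnerProduct.

(** The real line with multiplication as inner product is a case of the vector statement. *)
Lemma is_derive_lipschitz_near_real (R : realType) (g dg : R -> R) (t : R) :
  (\forall s \near t, is_derive (s : R) 1 g (dg s)) -> {for t, continuous dg} ->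
  \forall s \near t & v \near t, `|g v - g s| <= (`|dg t| + 1) * `|v - s|.
Proof.
apply: (@is_derive_lipschitz_near R R^o (fun a b => a * b)).
split; first by move=> a b; rewrite mulrC.
split; first by move=> a b c d; rewrite /GRing.scale/=; ring.
by move=> a; rewrite real_normK ?num_real.
Qed.

(* First-order optimality of the projection along the segments to the vertices [G i + b + w]. *)
Lemma proj_conv_hull (R : realType) (H : normedModType R) (ip : H -> H -> R)
    (hip : inner_product ip) (m : nat) (G : 'I_m.+1 -> H) (b w v : H) (c : R) :
  0 < c -> is_proj [set g + b + w | g in conv_hull G] 0 (- (c *: v)) ->
  (exists th : 'I_m.+1 -> R, [/\ forall i, 0 <= th i, \sum_i th i = 1 &
     w = - (\sum_i th i *: G i) - b - c *: v]) /\
  forall i, ip (G i) v + ip b v + ip w v + c * `|v| ^+ 2 <= 0.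
Proof.
move=> c0 [[g [th [th0 [th1 gE]]] gbw] pmin].
have wE : w = - g - b - c *: v by rewrite -gbw -opprD addKr.
split; first by exists th; rewrite -gE.
move=> i; pose pp := - (c *: v).
have ineq e : 0 < e -> e <= 1 -> 0 <= 2 * ip pp (G i - g) + e * `|G i - g| ^+ 2.
  move=> e0 e1.
  have /pmin : [set g + b + w | g in conv_hull G] (pp + e *: (G i - g)).
    exists (g + e *: (G i - g)); last by rewrite -addrA addrAC addrA gbw.
    exists (fun j => (1 - e) * th j + e * (j == i)%:R); split.
      by move=> j; rewrite addr_ge0// mulr_ge0 ?subr_ge0// ltW.
    split.
      have delta1 : \sum_j (j == i)%:R = 1 :> R.
        by rewrite (bigD1 i)//= eqxx big1 ?addr0// => j /negbTE ->.
      by rewrite big_split/= -!mulr_sumr th1 delta1 !mulr1 subrK.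
    under eq_bigr do rewrite scalerDl -!scalerA.
    rewrite big_split/= -!scaler_sumr -gE.
    have -> : \sum_j (j == i)%:R *: G j = G i.
      by rewrite (bigD1 i)//= eqxx scale1r big1 ?addr0// => j /negbTE ->; rewrite scale0r.
    by rewrite scalerBr scalerBl scale1r addrCA addrC.
  rewrite !subr0 -(ler_pXn2r (n := 2))// ?nnegrE// (normD2 hip) (ipZr hip) normrZ => h.
  have : 0 <= e * (2 * ip pp (G i - g) + e * `|G i - g| ^+ 2).
    by move: h; rewrite exprMn (ger0_norm (ltW e0)) expr2; lra.
  by rewrite pmulr_rge0.
have key : 0 <= ip pp (G i - g).
  apply/ler_addgt0Pr => e e0; pose N := `|G i - g| ^+ 2 + 1.
  have N0 : 0 < N by rewrite ltr_wpDl// exprn_ge0.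
  (* A step this short makes the quadratic term of [ineq] at most [e], which replaces the limit of
     vanishing steps. *)
  pose s := Num.min 1 (e / N).
  have s0 : 0 < s by rewrite lt_min ltr01 divr_gt0.
  have s1 : s <= 1 by rewrite ge_min lexx.
  have sN : s * N <= e by rewrite -ler_pdivlMr// ge_min lexx orbT.
  have := ineq _ s0 s1.
  have : s * `|G i - g| ^+ 2 <= s * N by rewrite ler_wpM2l ?(ltW s0)// lerDl.
  lra.
move: key; rewrite /pp (ipNl hip) (ipZl hip) oppr_ge0 pmulr_rle0//.
rewrite wE !(ipBl hip, ipNl hip, ipBr hip, ipZl hip) (ipxx hip) !(ipC hip v); lra.
Qed.

(** * Powers of time and derivative rules for real functions *)

Lemma invpowR_half (R : realType) (b p t : R) : b / (2 * t `^ p) = b / 2 * t `^ (- p).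
Proof. by rewrite powRN invfM mulrA. Qed.

Lemma dominated_powR (R : realType) (H : normedModType R) (u : R -> H) (c t : R) :
  0 < t -> dominated_near u (fun s => s `^ c) t.
Proof.
move=> t0; apply: (@dominated_lipschitz _ _ _ _ _ _ (`|c * t `^ (c - 1)| + 1)).
  by rewrite addr_ge0.
apply: (@is_derive_lipschitz_near_real _ (fun s => s `^ c) (fun s => c * s `^ (c - 1))).
  by near=> s; apply: is_derive1_powR; near: s; exact: lt_nbhsr.
apply: (@is_derive_continuous _ _ _ _ (c * ((c - 1) * t `^ (c - 1 - 1)))).
have -> : (fun s : R => c * s `^ (c - 1)) = c \*: (fun s : R => s `^ (c - 1)) by [].
by apply: is_deriveZ; exact: is_derive1_powR.
Unshelve. all: by end_near.
Qed.

Lemma dominated_cst (R : realType) (H V : normedModType R) (u : R -> H) (c : V) (t : R) :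
  dominated_near u (fun=> c) t.
Proof.
by apply: (@dominated_lipschitz _ _ _ _ _ _ 0) => //; apply: nearW2 => s v;
  rewrite subrr normr0 mul0r.
Qed.

Section RealDerive.
Variable R : realType.
Implicit Types (g h : R -> R) (t a b c : R).

Lemma is_derive_addr g h t a b : is_derive t 1 g a -> is_derive t 1 h b ->
  is_derive t 1 (fun s => g s + h s) (a + b).
Proof. exact: is_deriveD. Qed.

Lemma is_derive_mulr g h t a b : is_derive t 1 g a -> is_derive t 1 h b ->
  is_derive t 1 (fun s => g s * h s) (a * h t + g t * b).
Proof.
move=> ga hb; have := is_deriveM ga hb; rewrite /GRing.scale/= => gh.
by apply: is_derive_eq gh _; rewrite addrC (mulrC a).
Qed.

Lemma is_derive_scaler c g t a : is_derive t 1 g a -> is_derive t 1 (fun s => c * g s) (c * a).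
Proof. exact: is_deriveZ. Qed.

End RealDerive.

(** * The Lyapunov function with a fixed anchor *)

Section Trajectory.
Variables (R : realType) (H : normedModType R) (ip : H -> H -> R).
Hypothesis hip : inner_product ip.
Variables (m : nat) (f : 'I_m.+1 -> H -> R) (gf : 'I_m.+1 -> H -> H).
Hypothesis hconv : forall i, convex_fun (f i).
Hypothesis hgrad : forall i x, has_gradient ip (f i) x (gf i x).
Hypothesis hgcont : forall i, continuous (gf i).
Variables t0 alpha beta q p : R.
Hypotheses (ht0 : 0 < t0) (halpha : 0 < alpha) (hbeta : 0 < beta) (hp : 0 < p).
Variables x xd xdd : R -> H.
Hypothesis hx_deriv : forall t, t0 <= t -> has_deriv_on [set u | t0 <= u] x t (xd t).
Hypothesis hxd_cont : {within [set u | t0 <= u], continuous xd}.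
Hypothesis hxd_ac : forall T, t0 <= T -> abs_cont_on t0 T xd.

Definition regular_time (t : R) : Prop :=
  has_deriv_on [set u | t0 <= u] xd t (xdd t) /\
  is_proj [set c + (beta / t `^ p) *: x t + xdd t | c in conv_hull (fun i => gf i (x t))] 0
    (- ((alpha / t `^ q) *: xd t)).

Lemma has_deriv_on_interior (u : R -> H) (t : R) (d : H) :
  t0 < t -> has_deriv_on [set s | t0 <= s] u t d -> is_derive t 1 u d.
Proof.
move=> t0t ud; apply/is_derive_nearP => e /ud[del del0 D].
near=> v; apply: D; first by apply: ltW; near: v; exact: lt_nbhsr.
by rewrite distrC; near: v; apply/nbhs_ballP; exists del.
Unshelve. all: by end_near.
Qed.

Lemma traj_deriv t : t0 < t -> is_derive t 1 x (xd t).
Proof. by move=> t0t; apply: has_deriv_on_interior => //; apply: hx_deriv; exact: ltW. Qed.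

Lemma traj_cont t : t0 < t -> {for t, continuous x}.
Proof. by move=> /traj_deriv; exact: is_derive_continuous. Qed.

Lemma velocity_cont_at :
  {in `]t0, +oo[, continuous xd} /\ xd s @[s --> t0^'+] --> xd t0.
Proof. by apply/continuous_within_itvcyP; rewrite set_itvE. Qed.

Lemma velocity_cont t : t0 < t -> {for t, continuous xd}.
Proof. by move=> t0t; apply: velocity_cont_at.1; rewrite in_itv/= t0t. Qed.

Lemma traj_dominated t : t0 < t -> dominated_near xd x t.
Proof.
move=> t0t; apply: (@dominated_lipschitz _ _ _ _ _ _ (`|xd t| + 1)).
  by rewrite addr_ge0.
apply: (is_derive_lipschitz_near hip) (velocity_cont t0t).
by near=> s; apply: traj_deriv; near: s; exact: lt_nbhsr.
Unshelve. all: by end_near.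
Qed.

Lemma dominated_ip (v w : R -> H) t : t0 < t -> dominated_near xd v t ->
  dominated_near xd w t -> dominated_near xd (fun s => ip (v s) (w s)) t.
Proof.
move=> t0t vd wd; have xdc := velocity_cont t0t.
have vb := near_le_bound (dominated_continuous xdc vd).
have wb := near_le_bound (dominated_continuous xdc wd).
have C0 : 0 <= (`|v t| + 1) + (`|w t| + 1) by rewrite !addr_ge0.
apply: (dominated_comp2 C0 vd wd).
exists ([set s | `|w s| <= `|w t| + 1], [set s | `|v s| <= `|v t| + 1]) => //.
move=> [s s'] [/= ws vs].
have -> : ip (v s') (w s') - ip (v s) (w s) = ip (v s') (w s' - w s) + ip (v s' - v s) (w s).
  by rewrite (ipBr hip) (ipBl hip); ring.
apply: le_trans (ler_normD _ _) _; rewrite mulrDr addrC.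
apply: lerD; apply: le_trans (ip_cauchy hip _ _) _.
  rewrite mulrC; apply: ler_wpM2r => //; apply: (le_trans ws).
  by rewrite lerDr addr_ge0.
by apply: ler_wpM2r => //; apply: (le_trans vs); rewrite lerDl addr_ge0.
Qed.

(** Convexity bounds an increment of [f i] by the gradient at its endpoint. Using both orders of the
    endpoints gives a two-sided bound, with gradients bounded near [t] by continuity. *)
Lemma objective_dominated i t : t0 < t -> dominated_near xd (fun s => f i (x s)) t.
Proof.
move=> t0t; have xdm := traj_dominated t0t.
have gb : \forall s \near t, `|gf i (x s)| <= `|gf i (x t)| + 1.
  apply: (@near_le_bound _ _ (gf i \o x)); apply: continuous_comp; first exact: traj_cont.
  exact: hgcont.
have C0 : 0 <= `|gf i (x t)| + 1 by rewrite addr_ge0.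
apply: (dominated_comp2 C0 xdm xdm).
exists ([set s | `|gf i (x s)| <= `|gf i (x t)| + 1],
  [set s | `|gf i (x s)| <= `|gf i (x t)| + 1]) => // -[s v] [/= gs gv].
have up a b : `|gf i (x b)| <= `|gf i (x t)| + 1 ->
    f i (x b) - f i (x a) <= (`|gf i (x t)| + 1) * `|x b - x a|.
  move=> gab; have := convex_gradient_le hip (x a) (hconv i) (hgrad i (x b)).
  have := le_trans (ip_le hip (gf i (x b)) (x b - x a)) (ler_wpM2r (normr_ge0 _) gab).
  by rewrite !(ipBr hip); lra.
have h1 := up v s gs; have h2 := up s v gv; rewrite (distrC (x s)) in h1.
have : 0 <= (`|gf i (x t)| + 1) * `|x v - x s| by rewrite mulr_ge0.
rewrite mulrDr; move: h1 h2; move: (_ * _) => z h1 h2 z0.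
by rewrite ler_norml; apply/andP; split; lra.
Qed.

Definition gap (y : H) (i : 'I_m.+1) (s : R) : R :=
  f i (x s) - f i y + beta / 2 * s `^ (- p) * (`|x s| ^+ 2 - `|y| ^+ 2) + 2^-1 * `|xd s| ^+ 2.

Lemma gap_dominated y i t : t0 < t -> dominated_near xd (gap y i) t.
Proof.
move=> t0t; have xdc := velocity_cont t0t; have xdm := traj_dominated t0t.
have norm2_dom (w : R -> H) : dominated_near xd w t ->
    dominated_near xd (fun s => `|w s| ^+ 2) t.
  move=> wd; have -> : (fun s => `|w s| ^+ 2) = (fun s => ip (w s) (w s)).
    by apply/funext => s; rewrite (ipxx hip).
  exact: dominated_ip.
apply: dominatedD; last first.
  by apply: (dominatedM xdc); [exact: dominated_cst|apply: norm2_dom; exact: dominated_self].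
apply: dominatedD.
  by apply: dominatedD; [exact: objective_dominated|exact: dominated_cst].
apply: (dominatedM xdc).
  apply: (dominatedM xdc); first exact: dominated_cst.
  by apply: dominated_powR; exact: lt_trans t0t.
by apply: dominatedD; [exact: norm2_dom|exact: dominated_cst].
Qed.

(** The projection inequality at the vertex [i], tested against the velocity, absorbs the gradient,
    Tikhonov and acceleration terms. What remains is the damping and the derivative of [t^-p],
    neither of which depends on [i]. *)
Lemma gap_straddle y i t : t0 < t -> regular_time t ->
  straddle_le (gap y i) t (- (alpha * t `^ (- q) * `|xd t| ^+ 2) -
    p * beta / 2 * t `^ (- p - 1) * (`|x t| ^+ 2 - `|y| ^+ 2)).
Proof.
move=> t0t [xdder xproj]; have tp := lt_trans ht0 t0t.
have {}xdder := has_deriv_on_interior t0t xdder.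
have [_ /(_ i) vi] := proj_conv_hull hip (divr_gt0 halpha (powR_gt0 q tp)) xproj.
have d1 := is_derive_gradient hip (hgrad i (x t)) (traj_deriv t0t).
have d2 := is_derive_ip hip (traj_deriv t0t) (traj_deriv t0t).
have d3 := is_derive_ip hip xdder xdder.
have d4 : is_derive t 1 (fun s => s `^ (- p)) (- p * t `^ (- p - 1)) by exact: is_derive1_powR.
have gE : gap y i = fun s => f i (x s) + (- f i y + (beta / 2 * (s `^ (- p) *
    (ip (x s) (x s) + - `|y| ^+ 2)) + 2^-1 * ip (xd s) (xd s))).
  by apply/funext => s; rewrite /gap -!(ipxx hip); ring.
have gd := is_derive_addr d1 (is_derive_addr (is_derive_cst (- f i y) t 1)
  (is_derive_addr (is_derive_scaler (beta / 2)
    (is_derive_mulr d4 (is_derive_addr d2 (is_derive_cst (- `|y| ^+ 2) t 1))))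
    (is_derive_scaler 2^-1 d3))).
rewrite gE.
apply: straddle_leW (is_derive_straddle_le gd).
rewrite /GRing.scale/= !(ipC hip (xd t)) (ipxx hip) addr0.
move: vi; rewrite (ipZl hip) -(powRN t p) -(powRN t q); lra.
Qed.

Lemma ae_straddle_le (g : R -> R) (N : set R) (a b : R) :
  t0 < a -> a <= b -> (@lebesgue_measure R).-negligible N ->
  (forall t, t0 < t -> dominated_near xd g t) ->
  (forall t, a <= t -> ~ N t -> straddle_le g t 0) -> g b <= g a.
Proof.
move=> t0a ab Nneg gd gs; apply: (@straddle_dominated_le _ _ a b xd g N) => //.
- apply: (abs_cont_onS _ _ (hxd_ac (le_trans (ltW t0a) ab))) => //; exact: ltW.
- by move=> t /andP[a_t _]; apply: gd; exact: lt_le_trans a_t.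
- by move=> t /andP[a_t _]; exact: gs.
Qed.

Variable N : set R.
Hypothesis hN : (@lebesgue_measure R).-negligible N.
Hypothesis hreg : forall t, t0 <= t -> ~ N t -> regular_time t.

Lemma traj_cvg_at_right : x s @[s --> t0^'+] --> x t0.
Proof.
have [del del0 D] := hx_deriv (lexx t0) ltr01.
pose C := `|xd t0| + 1; have C0 : 0 < C by rewrite ltr_wpDl.
apply/cvgrPdist_le => e e0; near=> s.
have t0s : t0 <= s by apply: ltW; near: s; exact: nbhs_right_gt.
have sdel : `|s - t0| < del.
  rewrite ger0_norm ?subr_ge0// ltrBlDl; near: s; apply: nbhs_right_lt; lra.
have se : C * `|s - t0| <= e.
  rewrite mulrC -ler_pdivlMr// ger0_norm ?subr_ge0// lerBlDl; near: s; apply: nbhs_right_le.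
  by rewrite ltrDl divr_gt0.
apply: le_trans se; rewrite distrC; have := D _ t0s sdel; rewrite mul1r => h.
have -> : x s - x t0 = (x s - x t0 - (s - t0) *: xd t0) + (s - t0) *: xd t0 by rewrite subrK.
apply: le_trans (ler_normD _ _) _; rewrite normrZ /C mulrDl mul1r [leRHS]addrC.
by rewrite (mulrC `|xd t0|) lerD2r.
Unshelve. all: by end_near.
Qed.

Lemma objective_continuous i : continuous (f i).
Proof.
move=> y; have [del del0 D] := hgrad i y ltr01.
pose C := `|gf i y| + 1; have C0 : 0 < C by rewrite ltr_wpDl.
apply/cvgrPdist_le => e e0.
have m0 : 0 < Num.min del (e / C) by rewrite lt_min del0 divr_gt0.
apply/nbhs_ballP; exists (Num.min del (e / C)) => // y' /=.
rewrite -ball_normE/= distrC lt_min => /andP[/D + y'e].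
rewrite (addrC y) subrK mul1r => h; rewrite distrC.
have -> : f i y' - f i y = (f i y' - f i y - ip (gf i y) (y' - y)) + ip (gf i y) (y' - y).
  by rewrite subrK.
apply: le_trans (ler_normD _ _) _; have := ip_cauchy hip (gf i y) (y' - y).
have : C * `|y' - y| <= e by rewrite mulrC -ler_pdivlMr// ltW.
rewrite /C; lra.
Qed.

(* The energies [f_{t,i}(x(t)) + |x'(t)|^2 / 2], that is the gaps to [0], decrease. *)
Lemma traj_level i t : t0 <= t ->
  f i (x t) + beta / 2 * t `^ (- p) * `|x t| ^+ 2 <=
  f i (x t0) + (beta / 2 * t0 `^ (- p) * `|x t0| ^+ 2 + 2^-1 * `|xd t0| ^+ 2).
Proof.
rewrite le_eqVlt => /orP[/eqP <-|t0t].
  have : 0 <= 2^-1 * `|xd t0| ^+ 2 by rewrite mulr_ge0// exprn_ge0.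
  lra.
(* The derivative at [t0] is only one-sided, so decrease is shown from [s > t0] and then [s] tends
   to [t0] from the right. *)
have dec s : t0 < s -> s <= t -> gap 0 i t <= gap 0 i s.
  move=> t0s st; apply: (@ae_straddle_le _ N s t) => //.
    by move=> w; exact: gap_dominated.
  move=> w sw Nw; have t0w := lt_le_trans t0s sw.
  apply: straddle_leW (gap_straddle _ _ t0w (hreg (ltW t0w) Nw)).
  rewrite normr0 expr0n/= subr0.
  have h1 : 0 <= alpha * w `^ (- q) * `|xd w| ^+ 2.
    by rewrite !mulr_ge0 ?powR_ge0 ?exprn_ge0// ltW.
  have h2 : 0 <= p * beta / 2 * w `^ (- p - 1) * `|x w| ^+ 2.
    by rewrite !mulr_ge0 ?powR_ge0 ?exprn_ge0// ltW.
  lra.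
have lim : gap 0 i s @[s --> t0^'+] --> gap 0 i t0.
  have norm2 (w : R -> H) : w s @[s --> t0^'+] --> w t0 ->
      `|w s| ^+ 2 @[s --> t0^'+] --> `|w t0| ^+ 2.
    by move=> /cvg_norm wc; rewrite expr2; under eq_fun do rewrite expr2; exact: cvgM.
  apply: cvgD; last by apply: cvgM; [exact: cvg_cst|apply: norm2; exact: velocity_cont_at.2].
  apply: cvgD.
    apply: cvgB; last exact: cvg_cst.
    exact: (continuous_cvg _ (@objective_continuous i (x t0)) traj_cvg_at_right).
  apply: cvgM; last by apply: cvgB; [apply: norm2; exact: traj_cvg_at_right|exact: cvg_cst].
  apply: cvgM; first exact: cvg_cst.
  apply: cvg_at_right_filter.
  exact: (is_derive_continuous (is_derive1_powR (- p) ht0)).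
have : gap 0 i t <= gap 0 i t0.
  apply: (cvgr_to_ge lim); near=> s; apply: dec; first by near: s; exact: nbhs_right_gt.
  by near: s; exact: nbhs_right_le.
have : 0 <= 2^-1 * `|xd t| ^+ 2 by rewrite mulr_ge0// exprn_ge0.
rewrite /gap normr0 expr0n/= !subr0; lra.
Unshelve. all: by end_near.
Qed.

Definition mgap (y : H) (s : R) : R := minI (fun i => gap y i s).

(** The dynamics writes [x''] through a convex combination of gradients. Convexity bounds each
    gradient term by its gap, hence by the minimum [mgap], and the weights sum to one. Polarization
    of [ip (x t) (x t - y)] cancels the difference of squared norms left by the gaps. *)
Lemma acceleration_bound y t : t0 < t -> regular_time t ->
  ip (x t - y) (xdd t) <= - (mgap y t - 2^-1 * `|xd t| ^+ 2) -
    beta / 2 * t `^ (- p) * `|x t - y| ^+ 2 - alpha * t `^ (- q) * ip (x t - y) (xd t).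
Proof.
move=> t0t [_ xproj]; have tp := lt_trans ht0 t0t.
have [[th [th0 th1 ->]] _] := proj_conv_hull hip (divr_gt0 halpha (powR_gt0 q tp)) xproj.
rewrite !(ipBr hip _ (_ *: _)) (ipNr hip) !(ipZr hip) -!powRN !(ipC hip (x t - y)).
rewrite (ip_suml hip).
have hs : \sum_i th i * (mgap y t - 2^-1 * `|xd t| ^+ 2 -
      beta / 2 * t `^ (- p) * (`|x t| ^+ 2 - `|y| ^+ 2)) <=
    \sum_i th i * ip (gf i (x t)) (x t - y).
  apply: ler_sum => i _; apply: ler_wpM2l => //.
  have := minI_le (fun i => gap y i t) i; rewrite -/(mgap y t) /gap.
  have := convex_gradient_le hip y (hconv i) (hgrad i (x t)).
  by rewrite !(ipBr hip); lra.
rewrite -mulr_suml th1 mul1r in hs.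
have hU : ip (x t) (x t - y) = 2^-1 * (`|x t - y| ^+ 2 + `|x t| ^+ 2 - `|y| ^+ 2).
  by rewrite (normB2 hip) (ipBr hip) (ipxx hip); field.
rewrite hU; move: hs; rewrite (ipC hip (xd t)); lra.
Qed.

(** * Growth estimate for the weighted energy *)

Section Lyapunov.
Variables lam r : R.
Hypotheses (hr1 : r < 1) (hq : 0 < q) (hqr : q <= r) (hpq : p - q <= r) (hlam : 0 < lam).
Hypotheses (hlam2 : lam <= 2 * alpha / 3) (hlam3 : lam <= beta / alpha).

(** The integrating factor for the rate [lam * s^-r]. *)
Definition weight (s : R) : R := expR (lam / (1 - r) * s `^ (1 - r)).

(** [s^(-2r)] times the coefficient of the squared distance in the energy, including [lam^2 / 2]
    from the expanded square; hence [- lam^2] here against [- 2 * lam] in [energy]. *)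
Definition kcoef (s : R) : R := 2^-1 * (lam * r * s `^ (- r - 1) +
  (lam * alpha * s `^ (- r - q) + - lam ^+ 2 * s `^ (- r - r))).

(* [weight s * s^(-2r)] times the energy with [z(s)] replaced by [y]; see [lyap_energyE]. *)
Definition lyap (y : H) (s : R) : R := weight s * mgap y s + weight s *
  (lam * (s `^ (- r) * ip (x s - y) (xd s)) + kcoef s * ip (x s - y) (x s - y)).

(** The target rate [s^(3r-(p+1))] of the energy on the scale of [lyap], that is, multiplied by
    [weight s * s^(-2r)]. *)
Definition barrier (s : R) : R := weight s * s `^ (r - p - 1).

Lemma weight_gt0 s : 0 < weight s. Proof. exact: expR_gt0. Qed.

Lemma is_derive_weight (t : R) : 0 < t -> is_derive t 1 weight (weight t * (lam * t `^ (- r))).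
Proof.
move=> tp; have := is_derive1_comp (is_derive_expR _)
  (is_derive_scaler (lam / (1 - r)) (is_derive1_powR (1 - r) tp)).
move=> h; apply: (is_derive_eq h); congr (_ * _).
rewrite (_ : 1 - r - 1 = - r); last by ring.
by rewrite mulrA divfK// subr_eq0 gt_eqF.
Qed.

Lemma weight_dominated (t : R) : 0 < t -> dominated_near xd weight t.
Proof.
move=> tp; apply: (@dominated_lipschitz _ _ _ _ _ _ (`|weight t * (lam * t `^ (- r))| + 1)).
  by rewrite addr_ge0.
apply: (@is_derive_lipschitz_near_real _ weight (fun s => weight s * (lam * s `^ (- r)))).
  by near=> s; apply: is_derive_weight; near: s; exact: lt_nbhsr.
apply: is_derive_continuous (is_derive_mulr (is_derive_weight tp)
  (is_derive_scaler lam (is_derive1_powR (- r) tp))).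
Unshelve. all: by end_near.
Qed.

Lemma shift_dominated y t : t0 < t -> dominated_near xd (fun s => x s - y) t.
Proof.
by move=> t0t; apply: dominatedD; [exact: traj_dominated|exact: dominated_cst].
Qed.

Lemma kcoef_dominated t : t0 < t -> dominated_near xd kcoef t.
Proof.
move=> t0t; have xdc := velocity_cont t0t; have tp := lt_trans ht0 t0t.
have term c e : dominated_near xd (fun s => c * s `^ e) t.
  by apply: (dominatedM xdc); [exact: dominated_cst|exact: dominated_powR].
apply: (dominatedM xdc); first exact: dominated_cst.
by apply: dominatedD => //; exact: dominatedD.
Qed.

Lemma mgap_dominated y t : t0 < t -> dominated_near xd (mgap y) t.
Proof. by move=> t0t; apply: dominated_minI => i; exact: gap_dominated. Qed.

Lemma lyap_dominated y t : t0 < t -> dominated_near xd (lyap y) t.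
Proof.
move=> t0t; have xdc := velocity_cont t0t; have tp := lt_trans ht0 t0t.
have xyd := shift_dominated y t0t.
apply: dominatedD; first by apply: (dominatedM xdc); [exact: weight_dominated|exact: mgap_dominated].
apply: (dominatedM xdc); first exact: weight_dominated.
apply: dominatedD; last first.
  by apply: (dominatedM xdc); [exact: kcoef_dominated|exact: dominated_ip].
apply: (dominatedM xdc); first exact: dominated_cst.
apply: (dominatedM xdc); first exact: dominated_powR.
by apply: dominated_ip => //; exact: dominated_self.
Qed.

Lemma barrier_dominated t : t0 < t -> dominated_near xd barrier t.
Proof.
move=> t0t; have tp := lt_trans ht0 t0t.
by apply: (dominatedM (velocity_cont t0t)); [exact: weight_dominated|exact: dominated_powR].
Qed.

Lemma powRD_gt0 (t a b : R) : 0 < t -> t `^ (a + b) = t `^ a * t `^ b.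
Proof. by move=> /lt0r_neq0 t_neq0; rewrite powRD// t_neq0 implybT. Qed.

(* The coefficients of [X = <x - y, x'>] cancel; that of [V = |x'|^2] is nonpositive by [3 lam <= 2 alpha] and [e <= w], that of [U = |x - y|^2] by [lam alpha <= beta], [e w <= d] and [3 r ti <= lam e]. Here [e, w, d, ti] stand for [t^-r, t^-q, t^-p, t^-1]. *)
Lemma lyapunov_algebra (e w d ti M X U V Z NX NY : R) :
  0 <= e -> 0 <= w -> 0 <= d -> 0 <= ti -> 0 <= U -> 0 <= V -> 0 <= NX ->
  e <= w -> e * w <= d -> 3 * r * ti <= lam * e ->
  Z <= - (M - 2^-1 * V) - beta / 2 * d * U - alpha * w * X ->
  let k := 2^-1 * (lam * r * (e * ti) + (lam * alpha * (e * w) + - lam ^+ 2 * (e * e))) in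
  let dk := 2^-1 * (lam * r * ((- r - 1) * (e * ti * ti)) + (lam * alpha *
    ((- r - q) * (e * w * ti)) + - lam ^+ 2 * ((- r - r) * (e * e * ti)))) in
  lam * e * (M + (lam * (e * X) + k * U)) +
    (- (alpha * w * V) - p * beta / 2 * (d * ti) * (NX - NY)) +
    (lam * (- r * (e * ti) * X + e * (V + Z)) + (dk * U + k * (X + X)))
  <= p * beta / 2 * (d * ti) * NY.
Proof.
move=> e0 w0 d0 ti0 U0 V0 NX0 ew ewd eti Zle; cbv zeta.
have r0 : 0 <= r := le_trans (ltW hq) hqr.
have la : lam * alpha <= beta by rewrite -ler_pdivlMr.
have la2 : 3 * lam / 2 <= alpha by move: hlam2; rewrite !ler_pdivlMr ?ler_pdivrMr//; lra.
have h1 : lam * e * Z <= lam * e * (- (M - 2^-1 * V) - beta / 2 * d * U - alpha * w * X).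
  by rewrite ler_wpM2l// mulr_ge0// ltW.
have h2 : 0 <= (alpha * w - 3 * lam / 2 * e) * V.
  rewrite mulr_ge0// subr_ge0; apply: (@le_trans _ _ (alpha * e)).
    by rewrite ler_wpM2r.
  by rewrite ler_wpM2l// ltW.
have lam0 : 0 <= lam / 2 by rewrite divr_ge0// ltW.
have h3 : 0 <= lam / 2 * (e * (beta * d - lam * alpha * (e * w))) * U.
  rewrite mulr_ge0//; apply: mulr_ge0 => //; apply: mulr_ge0 => //; rewrite subr_ge0.
  apply: (@le_trans _ _ (beta * (e * w))); first by rewrite ler_wpM2r// mulr_ge0.
  by rewrite ler_wpM2l// ltW.
have h4 : 0 <= lam / 2 * (lam * (e * e) * (lam * e - 3 * r * ti)) * U.
  rewrite mulr_ge0//; apply: mulr_ge0 => //; apply: mulr_ge0; last by rewrite subr_ge0.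
  by apply: mulr_ge0; [exact: ltW|exact: mulr_ge0].
have h5 : 0 <= lam / 2 * (r * (r + 1) * (e * ti * ti) + alpha * (r + q) * (e * w * ti)) * U.
  have [? ?] := (ltW halpha, ltW hq).
  by do ?[done|apply: mulr_ge0|apply: addr_ge0].
have h6 : 0 <= p * beta / 2 * (d * ti) * NX.
  by have [? ?] := (ltW hp, ltW hbeta); do ?[done|apply: mulr_ge0|apply: divr_ge0].
lra.
Qed.

(** The minimum of the gaps has only a straddle bound, while the rest of [lyap] is differentiable at
    regular times; the two bounds add. Since [1 <= t], the conditions on [q], [p] and [r] become the
    power comparisons used in [lyapunov_algebra]. *)
Lemma lyap_straddle y t : t0 < t -> 1 <= t -> 3 * r * t^-1 <= lam * t `^ (- r) ->
  regular_time t ->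
  straddle_le (lyap y) t (weight t * (p * beta / 2 * t `^ (- p - 1) * `|y| ^+ 2)).
Proof.
move=> t0t t1 tr treg; have tp := lt_trans ht0 t0t.
have xdder := has_deriv_on_interior t0t treg.1.
have mstr : straddle_le (mgap y) t (- (alpha * t `^ (- q) * `|xd t| ^+ 2) -
    p * beta / 2 * t `^ (- p - 1) * (`|x t| ^+ 2 - `|y| ^+ 2)).
  by apply: straddle_le_minI => i; exact: gap_straddle.
have mcont := dominated_continuous (velocity_cont t0t) (mgap_dominated y t0t).
have wder := is_derive_weight tp.
have s1 := straddle_leM wder (weight_gt0 t) mcont mstr.
have pder c := is_derive1_powR c tp.
have uder : is_derive t 1 (fun s => x s - y) (xd t).
  by have := is_deriveB (traj_deriv t0t) (is_derive_cst y t 1); rewrite subr0.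
have xder := is_derive_mulr (pder (- r)) (is_derive_ip hip uder xdder).
have kder := is_derive_scaler 2^-1 (is_derive_addr
  (is_derive_scaler (lam * r) (pder (- r - 1)))
  (is_derive_addr (is_derive_scaler (lam * alpha) (pder (- r - q)))
    (is_derive_scaler (- lam ^+ 2) (pder (- r - r))))).
have hder := is_derive_mulr wder (is_derive_addr (is_derive_scaler lam xder)
  (is_derive_mulr kder (is_derive_ip hip uder uder))).
have s2 := is_derive_straddle_le hder.
apply: straddle_leW (straddle_leD s1 s2).
rewrite /kcoef !(ipC hip (xd t) (x t - y)) (ipxx hip (x t - y)) (ipxx hip (xd t)).
rewrite !(powRD_gt0 _ _ tp) (powR_inv1 (ltW tp)).
have ti0 : 0 <= t^-1 by rewrite invr_ge0 ltW.
have ew : t `^ (- r) <= t `^ (- q) by rewrite ler_powR// lerN2.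
have ewd : t `^ (- r) * t `^ (- q) <= t `^ (- p).
  by rewrite -(powRD_gt0 _ _ tp) ler_powR//; move: hpq; lra.
have alg := lyapunov_algebra (`|y| ^+ 2) (powR_ge0 _ _) (powR_ge0 _ _) (powR_ge0 _ _)
  ti0 (exprn_ge0 2 (normr_ge0 _)) (exprn_ge0 2 (normr_ge0 _))
  (exprn_ge0 2 (normr_ge0 (x t))) ew ewd tr (acceleration_bound y t0t treg).
have := ler_wpM2l (ltW (weight_gt0 t)) alg.
move: (weight t) => a; lra.
Qed.

(** Differentiating the weight contributes [lam * t^(-p-1)]; for such [t], the loss
    [(p + 1 - r) * t^(r-p-2)] from the power is at most half of it. *)
Lemma barrier_derive_ge (t : R) : 0 < t -> 2 * (p + 1 - r) * t^-1 <= lam * t `^ (- r) ->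
  exists2 db, is_derive t 1 barrier db & weight t * (lam / 2 * t `^ (- p - 1)) <= db.
Proof.
move=> tp tr; have bder := is_derive_mulr (is_derive_weight tp) (is_derive1_powR (r - p - 1) tp).
eexists; first exact: bder.
rewrite -!mulrA -mulrDr; apply: ler_wpM2l; first exact: ltW (weight_gt0 t).
rewrite !(powRD_gt0 _ _ tp) (powR_inv1 (ltW tp)).
have eE : t `^ (- r) * t `^ r = 1 by rewrite -(powRD_gt0 _ _ tp) addNr powRr0.
have D0 : 0 <= t `^ r * (t `^ (- p) * t^-1) by rewrite !mulr_ge0 ?powR_ge0 ?invr_ge0 ?(ltW tp).
have := ler_wpM2r D0 tr.
have -> : lam * t `^ (- r) * (t `^ r * (t `^ (- p) * t^-1)) =
  lam * (t `^ (- p) * t^-1) * (t `^ (- r) * t `^ r) by ring.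
have -> : lam * (t `^ (- r) * (t `^ r * t `^ (- p) * t^-1)) =
  lam * (t `^ (- p) * t^-1) * (t `^ (- r) * t `^ r) by ring.
rewrite eE; lra.
Qed.

Section Estimate.
Variable t1 : R.
Hypotheses (t01 : t0 < t1) (t1ge1 : 1 <= t1).
Hypothesis t1r : forall t, t1 <= t ->
  3 * r * t^-1 <= lam * t `^ (- r) /\ 2 * (p + 1 - r) * t^-1 <= lam * t `^ (- r).

Lemma barrier_mono T : t1 <= T -> barrier t1 <= barrier T.
Proof.
move=> t1T; rewrite -lerN2.
apply: (@ae_straddle_le (fun s => - barrier s) N t1 T) => //.
  move=> t t0t; have -> : (fun s => - barrier s) = (fun s => (-1) * barrier s).
    by apply/funext => s; rewrite mulN1r.
  by apply: (dominatedM (velocity_cont t0t)); [exact: dominated_cst|exact: barrier_dominated].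
move=> t t1t _; have tp : 0 < t by apply: lt_le_trans t1t; exact: lt_trans t01.
have [db bder dbge] := barrier_derive_ge tp (t1r t1t).2.
have := is_derive_straddle_le (is_derive_scaler (-1) bder).
have -> : (fun s => (-1) * barrier s) = (fun s => - barrier s).
  by apply/funext => s; rewrite mulN1r.
apply: straddle_leW; rewrite mulN1r oppr_le0; apply: le_trans dbge.
have [? ?] := (ltW hlam, ltW (weight_gt0 t)).
by do ?[done|apply: mulr_ge0|apply: divr_ge0|exact: powR_ge0].
Qed.

Lemma lyap_le y T : t1 <= T ->
  lyap y T <= lyap y t1 + p * beta * `|y| ^+ 2 / lam * barrier T.
Proof.
(* [K] is the ratio between the slope bound of [lyap] and the lower bound on the slope of [barrier],
   so [lyap - K * barrier] does not increase. *)
move=> t1T; set K := p * beta * `|y| ^+ 2 / lam.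
have K0 : 0 <= K.
  have [? ? ?] := And3 (ltW hp) (ltW hbeta) (ltW hlam).
  by do ?[done|apply: divr_ge0|apply: mulr_ge0|exact: exprn_ge0].
have : lyap y T + - K * barrier T <= lyap y t1 + - K * barrier t1.
  apply: (@ae_straddle_le (fun s => lyap y s + - K * barrier s) N t1 T) => //.
    move=> t t0t; apply: dominatedD; first exact: lyap_dominated.
    by apply: (dominatedM (velocity_cont t0t)); [exact: dominated_cst|exact: barrier_dominated].
  move=> t t1t Nt; have t0t := lt_le_trans t01 t1t; have tp := lt_trans ht0 t0t.
  have [tr1 tr2] := t1r t1t.
  have [db bder dbge] := barrier_derive_ge tp tr2.
  have := straddle_leD (lyap_straddle y t0t (le_trans t1ge1 t1t) tr1 (hreg (ltW t0t) Nt))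
    (is_derive_straddle_le (is_derive_scaler (- K) bder)).
  apply: straddle_leW.
  have := ler_wpM2l K0 dbge.
  have -> : K * (weight t * (lam / 2 * t `^ (- p - 1))) =
      weight t * (p * beta / 2 * t `^ (- p - 1) * `|y| ^+ 2).
    by rewrite /K; field; rewrite gt_eqF.
  lra.
have : 0 <= K * barrier t1.
  apply: mulr_ge0 => //; apply: mulr_ge0; last exact: powR_ge0.
  exact: ltW (weight_gt0 t1).
lra.
Qed.

End Estimate.

(** The inequality follows from [t^(1-r) >= |K| / lam], which holds for large [t] because
    [r < 1]. *)
Lemma threshold (K : R) : exists2 T, 1 <= T &
  forall t, T <= t -> K * t^-1 <= lam * t `^ (- r).
Proof.
have r1 : 0 < 1 - r by rewrite subr_gt0.
pose s := (`|K| / lam) `^ (1 - r)^-1.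
have sE : s `^ (1 - r) = `|K| / lam.
  by rewrite -powRrM mulVf ?gt_eqF// powRr1// divr_ge0// ltW.
exists (Num.max 1 s) => [|t]; first by rewrite le_max lexx.
rewrite ge_max => /andP[t1 st]; have tp : 0 < t := lt_le_trans ltr01 t1.
have : `|K| / lam <= t `^ (1 - r).
  by rewrite -sE ge0_ler_powR ?nnegrE ?powR_ge0// ltW.
rewrite ler_pdivrMr// => h.
rewrite ler_pdivrMr//; apply: (le_trans (ler_norm K)); apply: (le_trans h).
by rewrite mulrC -mulrA -{3}(powRr1 (ltW tp)) -powRD_gt0// (addrC (- r)).
Qed.

(** The bound must be uniform in [y], which is chosen only after the final time. The tangent of one
    convex objective at [0] bounds [- f ord0 y] from above on the ball of radius [Y]. *)
Lemma lyap_start_bound (Y s : R) : 0 < s ->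
  exists C, forall y, `|y| <= Y -> lyap y s <= C.
Proof.
move=> sp; pose D := `|x s| + Y.
exists (weight s * (f ord0 (x s) - f ord0 0 + `|gf ord0 0| * Y +
  beta / 2 * s `^ (- p) * `|x s| ^+ 2 + 2^-1 * `|xd s| ^+ 2) +
  weight s * (lam * (s `^ (- r) * (D * `|xd s|)) + `|kcoef s| * D ^+ 2)) => y yY.
have w0 := ltW (weight_gt0 s).
have uD : `|x s - y| <= D by apply: le_trans (ler_normB _ _) _; rewrite lerD2l.
apply: lerD; apply: ler_wpM2l => //.
  apply: (le_trans (minI_le _ ord0)); rewrite /gap.
  have := convex_gradient_le hip y (hconv ord0) (hgrad ord0 0); rewrite subr0.
  have := ip_cauchy hip (gf ord0 0) y; rewrite ler_norml => /andP[].
  have : `|gf ord0 0| * `|y| <= `|gf ord0 0| * Y by rewrite ler_wpM2l.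
  have : 0 <= beta / 2 * s `^ (- p) * `|y| ^+ 2.
    have := ltW hbeta; move=> ?.
    by do ?[done|exact: exprn_ge0|exact: powR_ge0|apply: mulr_ge0].
  lra.
apply: lerD.
  apply: ler_wpM2l; first exact: ltW.
  apply: ler_wpM2l; first exact: powR_ge0.
  by apply: (le_trans (ip_le hip _ _)); rewrite ler_wpM2r.
rewrite (ipxx hip); apply: (@le_trans _ _ (`|kcoef s| * `|x s - y| ^+ 2)).
  by rewrite ler_wpM2r ?exprn_ge0// ler_norm.
by rewrite ler_wpM2l// ler_sqr ?nnegrE// (le_trans _ uD).
Qed.

(** Since [barrier] increases, the starting value is absorbed into a multiple of [barrier t]. The
    constants depend on [y] only through [Y], so the anchor may vary with [t]. *)
Lemma lyap_rate (Y : R) : 0 <= Y -> exists C T, [/\ 0 <= C, 1 <= T, t0 < T &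
  forall t y, T <= t -> `|y| <= Y ->
    t `^ (2 * r) / weight t * lyap y t <= C * t `^ (3 * r - (p + 1))].
Proof.
move=> Y0; have [T1 T11 HT1] := threshold (3 * r).
have [T2 T21 HT2] := threshold (2 * (p + 1 - r)).
pose t1 : R := Num.max (t0 + 1) (Num.max T1 T2).
have t01 : t0 < t1 by rewrite lt_max ltrDl ltr01.
have t1ge1 : 1 <= t1 by rewrite !le_max T11 orbT.
have t1r (t : R) : t1 <= t ->
    3 * r * t^-1 <= lam * t `^ (- r) /\ 2 * (p + 1 - r) * t^-1 <= lam * t `^ (- r).
  by rewrite !ge_max => /andP[_ /andP[? ?]]; split; [exact: HT1|exact: HT2].
have t1p : 0 < t1 := lt_le_trans ltr01 t1ge1.
have [C0 HC0] := lyap_start_bound Y t1p.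
have b1 : 0 < barrier t1 by rewrite mulr_gt0 ?weight_gt0// powR_gt0.
pose K := p * beta * Y ^+ 2 / lam.
have K0 : 0 <= K.
  have [? ? ?] := And3 (ltW hp) (ltW hbeta) (ltW hlam).
  by do ?[done|apply: divr_ge0|apply: mulr_ge0|exact: exprn_ge0].
have Cb0 : 0 <= `|C0| / barrier t1 by rewrite divr_ge0// ltW.
exists (`|C0| / barrier t1 + K), t1; split => // [|t y t1t yY]; first exact: addr_ge0.
have tp := lt_le_trans t1p t1t.
have bt := barrier_mono t01 t1r t1t.
have bt0 : 0 <= barrier t := le_trans (ltW b1) bt.
have hl : lyap y t <= (`|C0| / barrier t1 + K) * barrier t.
  have ll := lyap_le t01 t1ge1 t1r y t1t; apply: (le_trans ll); rewrite mulrDl; apply: lerD.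
    apply: (le_trans (HC0 _ yY)); apply: (le_trans (ler_norm _)).
    by rewrite -mulrA ler_peMr// mulrC ler_pdivlMr// mul1r.
  rewrite ler_wpM2r// /K ler_wpM2r ?invr_ge0 ?(ltW hlam)//.
  by rewrite ler_wpM2l ?mulr_ge0 ?(ltW hp) ?(ltW hbeta)// ler_sqr ?nnegrE.
have w0 := weight_gt0 t.
apply: (@le_trans _ _ (t `^ (2 * r) / weight t * ((`|C0| / barrier t1 + K) * barrier t))).
  by rewrite ler_wpM2l// divr_ge0 ?powR_ge0// ltW.
rewrite le_eqVlt; apply/orP; left; apply/eqP.
rewrite (_ : 3 * r - (p + 1) = 2 * r + (r - p - 1)); last by ring.
rewrite (powRD_gt0 (2 * r))// /barrier; move: (`|C0| / _ + K) => c; field.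
by rewrite gt_eqF.
Qed.

End Lyapunov.

(** The kinetic term is common to all gaps and leaves the minimum; together with the terms in [lam]
    and [kcoef] it completes the square of the energy. *)
Lemma lyap_energyE (lam r : R) (y : H) (t : R) : 0 < t ->
  t `^ (2 * r) / weight lam r t * lyap lam r y t =
  t `^ (2 * r) * minI (fun i => f_t f beta p t i (x t) - f_t f beta p t i y) +
   (2^-1 * `|lam *: (x t - y) + t `^ r *: xd t| ^+ 2 +
    lam / 2 * (r * t `^ (r - 1) + alpha * t `^ (r - q) - 2 * lam) * `|x t - y| ^+ 2).
Proof.
move=> tp.
have -> : minI (fun i => f_t f beta p t i (x t) - f_t f beta p t i y) =
    mgap y t - 2^-1 * `|xd t| ^+ 2.
  have gE i : gap y i t =
      (f_t f beta p t i (x t) - f_t f beta p t i y) + 2^-1 * `|xd t| ^+ 2.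
    by rewrite /gap /f_t invpowR_half; ring.
  apply/eqP; rewrite eq_le; apply/andP; split.
    rewrite lerBrDr; apply: minI_ge => i; rewrite gE lerD2r.
    exact: (minI_le (fun i => f_t f beta p t i (x t) - f_t f beta p t i y)).
  apply: minI_ge => i; rewrite lerBlDr -gE; exact: (minI_le (gap y ^~ t)).
rewrite (normD2 hip) !normrZ !exprMn !real_normK ?num_real// (ipZl hip) (ipZr hip).
rewrite /lyap /kcoef (ipxx hip).
rewrite (_ : 2 * r = r + r) ?mulrDl ?mul1r; last by ring.
rewrite !(powRD_gt0 _ _ tp) (powR_inv1 (ltW tp)) !(powRN t r).
have e0 : t `^ r != 0 by rewrite gt_eqF// powR_gt0.
have w0 : weight lam r t != 0 by rewrite gt_eqF// weight_gt0.
have t_0 : t != 0 by rewrite gt_eqF.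
move: (t `^ r) (weight lam r t) (t `^ (- q)) e0 w0 => E W w E0 W0.
by field; rewrite ?E0 ?W0 ?t_0.
Qed.

(** Decrease along the trajectory puts [y] in the initial level set. (A3) then gives a weakly Pareto
    optimal point below [y], and a point with the same objective values and norm at most [Y]. *)
Lemma bounded_dominating_point :
  A3 f t0 beta p (x t0) (xd t0) ->
  exists2 Y : R, 0 <= Y & forall t y, t0 <= t -> (forall i, f i y <=
      f i (x t) + beta / 2 * t `^ (- p) * `|x t| ^+ 2) ->
    exists2 y', `|y'| <= Y & forall i, f i y' <= f i y.
Proof.
rewrite /A3 invpowR_half; set a := _ + 2^-1 * _; move=> [ne fin].
move: fin; set S := ereal_sup _ => fin.
(* [Y] lies strictly above the supremum, so that an infimum of norms, attained or not, is undercut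
   by an actual point. *)
have [Y Y0 SY] : exists2 Y : R, 0 <= Y & (S < Y%:E)%E.
  move: fin; case: S => [s| |] // _.
    by exists (`|s| + 1); rewrite ?addr_ge0// lte_fin ltr_pwDr ?ler_norm.
  by exists 0 => //; rewrite ltNyr.
exists Y => // t y t0t fy.
have yb : level_set f (fun i => f i (x t0) + a) y.
  by move=> i; apply: (le_trans (fy i)); exact: traj_level.
have [y1 [y1y y1p]] := ne _ yb.
have y1b : LPw f (fun i => f i (x t0) + a) y1.
  by split => // i; exact: le_trans (y1y i) (yb i).
have infS : (ereal_inf [set (`|z|)%:E | z in [set z | forall i, f i z = f i y1]] <= S)%E.
  by apply: ereal_sup_ubound; exists y1.
have [_ [y' y'E <-]] := ereal_inf_lt (le_lt_trans infS SY).
rewrite lte_fin => y'Y; exists y'; first exact: ltW.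
by move=> i; rewrite y'E.
Qed.

End Trajectory.

(** * Convergence rates *)

(** By strong convexity, the value at [s *: y + (1 - s) *: z] falls below the interpolated value by
    [c * s * (1 - s)] times the squared distance. Minimality of [z], division by [s] and small [s]
    give the growth. *)
Lemma max_argmin_growth (R : realType) (H : normedModType R) (ip : H -> H -> R)
    (hip : inner_product ip) (m : nat) (h : 'I_m.+1 -> H -> R) (c : R) (w : 'I_m.+1 -> R)
    (z : H) : 0 <= c -> (forall i, convex_fun (h i)) ->
  let g := fun y => maxI (fun i => h i y + c * `|y| ^+ 2 - w i) in
  argmin_set g z -> forall y, g z + c * `|y - z| ^+ 2 <= g y.
Proof.
move=> c0 hconv g zmin y; set D := `|y - z| ^+ 2.
have D0 : 0 <= c * D by rewrite mulr_ge0// exprn_ge0.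
have step s : 0 < s -> s <= 1 -> g z + c * (1 - s) * D <= g y.
  move=> s0 s1.
  have : g z <= s * g y + (1 - s) * g z - c * s * (1 - s) * D.
    apply: (le_trans (zmin (s *: y + (1 - s) *: z))); apply: maxI_le => i.
    have yi : h i y + c * `|y| ^+ 2 - w i <= g y.
      exact: (maxI_ge (fun i => h i y + c * `|y| ^+ 2 - w i)).
    have zi : h i z + c * `|z| ^+ 2 - w i <= g z.
      exact: (maxI_ge (fun i => h i z + c * `|z| ^+ 2 - w i)).
    have := hconv i y z s; rewrite (ltW s0) s1 => /(_ isT) conv.
    have := ler_wpM2l (ltW s0) yi; have s1' : 0 <= 1 - s by rewrite subr_ge0.
    have := ler_wpM2l s1' zi; rewrite /D (normD2 hip) (normB2 hip) !normrZ !exprMn.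
    rewrite (ipZl hip) (ipZr hip) !(ger0_norm (ltW s0)) !(ger0_norm s1'); lra.
  move=> h1; rewrite -(ler_pM2l s0); lra.
apply/ler_addgt0Pr => e e0; pose K := c * D + 1.
have K0 : 0 < K by rewrite ltr_wpDl.
pose s := Num.min 1 (e / K).
have s0 : 0 < s by rewrite lt_min ltr01 divr_gt0.
have s1 : s <= 1 by rewrite ge_min lexx.
have sK : s * K <= e by rewrite -ler_pdivlMr// ge_min lexx orbT.
have := step _ s0 s1; rewrite /K in sK; lra.
Qed.

Lemma sqr_le_powR (R : realType) (a C t c : R) :
  0 <= a -> 0 <= C -> a ^+ 2 <= C * t `^ c -> a <= Num.sqrt C * t `^ (c / 2).
Proof.
move=> a0 C0 h; rewrite -ler_sqr ?nnegrE ?mulr_ge0 ?sqrtr_ge0 ?powR_ge0//.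
rewrite exprMn sqr_sqrtr//; apply: (le_trans h); rewrite -powR_mulrn ?powR_ge0//.
by rewrite -powRrM divfK.
Qed.

Lemma merit_tE (R : realType) (H : normedModType R) (m : nat) (f : 'I_m.+1 -> H -> R)
    (beta p t : R) (y z : H) :
  argmin_set (fun y' => maxI (fun i => f_t f beta p t i y' - f_t f beta p t i y)) z ->
  merit_t f beta p t y = (minI (fun i => f_t f beta p t i y - f_t f beta p t i z))%:E.
Proof.
move=> zmin; apply/eqP; rewrite eq_le; apply/andP; split.
  apply: ge_ereal_sup => _ [y' _ <-]; rewrite lee_fin !minI_oppmax lerN2; exact: zmin.
by apply: ereal_sup_ubound; exists z.
Qed.

Unset Implicit Arguments.

Theorem mainTheorem13
  (R : realType) (H : completeNormedModType R) (ip : H -> H -> R)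
  (hip : inner_product ip)
  (m : nat) (f : 'I_m.+1 -> H -> R) (gf : 'I_m.+1 -> H -> H)
  (hconv : forall i, convex_fun (f i))
  (hgrad : forall i x, has_gradient ip (f i) x (gf i x))
  (hgcont : forall i, continuous (gf i))
  (hlip : forall i, lipschitz (gf i))
  (t0 alpha beta q p : R) (x0 v0 : H)
  (ht0 : 0 < t0) (halpha : 0 < alpha) (hbeta : 0 < beta)
  (hq : 0 < q < 1) (hp : 0 < p <= 2) (hpq : p < q + 1)
  (hA3 : A3 f t0 beta p x0 v0) (hA4 : A4 f)
  (x xd xdd : R -> H)
  (hx_deriv : forall t, t0 <= t -> has_deriv_on [set u | t0 <= u] x t (xd t))
  (hxd_cont : {within [set u | t0 <= u], continuous xd})
  (hxd_ac : forall T, t0 <= T -> abs_cont_on t0 T xd)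
  (hdyn : {ae @lebesgue_measure R, forall t, t0 <= t ->
            has_deriv_on [set u | t0 <= u] xd t (xdd t) /\
            is_proj [set c + (beta / t `^ p) *: x t + xdd t
                    | c in conv_hull (fun i => gf i (x t))] 0
                    (- ((alpha / t `^ q) *: xd t))})
  (hx0 : x t0 = x0) (hv0 : xd t0 = v0)
  (z : R -> H)
  (hz : forall t, t0 <= t ->
     argmin_set (fun y => maxI (fun i => f_t f beta p t i y - f_t f beta p t i (x t)))
                (z t)) :
  forall r : R, q <= r -> p - q <= r -> r < 1 ->
  [/\ (forall lam : R, 0 < lam -> lam <= 2 * alpha / 3 -> lam <= beta / alpha ->
        exists C T : R, forall t, T <= t ->
          (`| energy f alpha beta p q r lam x z xd t | <= (C * t `^ (3 * r - (p + 1)))%:E)%E),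
      (exists C T : R, forall t, T <= t ->
          (`| merit_t f beta p t (x t) | <= (C * t `^ (r - (p + 1)))%:E)%E),
      (exists C T : R, forall t, T <= t ->
          (`| merit f (x t) | <= (C * t `^ (- p))%:E)%E),
      (exists C T : R, forall t, T <= t ->
          `| x t - z t | <= C * t `^ ((r - 1) / 2)) &
      (exists C T : R, forall t, T <= t ->
          `| xd t | <= C * t `^ ((r - (p + 1)) / 2))].
Proof.
have [/andP[hq0 hq1] /andP[hp0 _]] := (hq, hp).
move=> r hqr hpqr hr1; have hpqr' : p - q <= r := hpqr.
pose N : set R := ~` [set t | t0 <= t -> regular_time gf t0 alpha beta q p x xd xdd t].
have hN : (@lebesgue_measure R).-negligible N := hdyn.
have hreg t : t0 <= t -> ~ N t -> regular_time gf t0 alpha beta q p x xd xdd t.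
  by move=> t0t /contrapT; apply.
have level := traj_level hip hconv hgrad hgcont ht0 halpha hbeta hp0 hx_deriv hxd_cont hxd_ac hN hreg.
rewrite -hx0 -hv0 in hA3.
have [Y Y0 HY] := bounded_dominating_point hip hconv hgrad hgcont ht0 halpha hbeta hp0
  hx_deriv hxd_cont hxd_ac hN hreg hA3.
pose c t := beta / (2 * t `^ p).
have cE t : c t = beta / 2 * t `^ (- p) by exact: invpowR_half.
have c0 t : 0 <= c t by rewrite cE mulr_ge0 ?powR_ge0// divr_ge0// ltW.
pose phi t := minI (fun i => f_t f beta p t i (x t) - f_t f beta p t i (z t)).
have phiE t : t0 <= t -> merit_t f beta p t (x t) = (phi t)%:E.
  by move=> /hz; exact: merit_tE.
(* Quadratic growth from [z t] to [x t], where the maximum is at most zero and its minimal value is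
   [- phi t]. *)
have phi_ge t : t0 <= t -> c t * `|x t - z t| ^+ 2 <= phi t.
  move=> t0t; have := max_argmin_growth hip (c0 t) hconv (hz t t0t) (x t).
  rewrite /phi minI_oppmax.
  have : maxI (fun i => f_t f beta p t i (x t) - f_t f beta p t i (x t)) <= 0.
    by apply: maxI_le => i; rewrite subrr.
  rewrite /f_t -/(c t); lra.
have phi0 t : t0 <= t -> 0 <= phi t.
  by move=> t0t; apply: le_trans (phi_ge t t0t); rewrite mulr_ge0 ?exprn_ge0.
(* Since [phi t >= 0], the point [z t] is dominated by some [y'] of norm at most [Y]. A norm of
   [z t] above that of [y'] would let [y'] beat [z t] through the Tikhonov term. *)
have zY t : t0 <= t -> `|z t| <= Y.
  move=> t0t; have [y' y'Y y'z] : exists2 y', `|y'| <= Y & forall i, f i y' <= f i (z t).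
    apply: (HY t (z t) t0t) => i.
    have := le_trans (phi0 t t0t)
      (minI_le (fun i => f_t f beta p t i (x t) - f_t f beta p t i (z t)) i).
    have : 0 <= c t * `|z t| ^+ 2 by rewrite mulr_ge0 ?exprn_ge0.
    rewrite /f_t -/(c t) -cE; lra.
  apply: le_trans y'Y.
  have ct : 0 < c t by rewrite cE mulr_gt0 ?divr_gt0// powR_gt0// (lt_le_trans ht0).
  rewrite -ler_sqr ?nnegrE// -(ler_pM2l ct).
  pose gz := maxI (fun i => f_t f beta p t i (z t) - f_t f beta p t i (x t)).
  have hgz : gz <= maxI (fun i => f_t f beta p t i y' - f_t f beta p t i (x t)).
    exact: hz.
  suff : gz <= gz + (c t * `|y'| ^+ 2 - c t * `|z t| ^+ 2) by lra.
  apply: (le_trans hgz); apply: maxI_le => i.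
  have := maxI_ge (fun i => f_t f beta p t i (z t) - f_t f beta p t i (x t)) i.
  by rewrite -/gz /f_t -/(c t); have := y'z i; lra.
pose en lam t := t `^ (2 * r) * phi t +
   (2^-1 * `|lam *: (x t - z t) + t `^ r *: xd t| ^+ 2 +
    lam / 2 * (r * t `^ (r - 1) + alpha * t `^ (r - q) - 2 * lam) * `|x t - z t| ^+ 2).
have enE lam t : t0 <= t -> energy f alpha beta p q r lam x z xd t = (en lam t)%:E.
  by move=> t0t; rewrite /energy phiE.
have r0 : 0 <= r by apply: le_trans hqr; exact: ltW.
have en_rate lam : 0 < lam -> lam <= 2 * alpha / 3 -> lam <= beta / alpha ->
    exists C T, [/\ 0 <= C, 1 <= T, t0 < T &
      forall t, T <= t -> en lam t <= C * t `^ (3 * r - (p + 1))].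
  move=> l0 l1 l2.
  have [C [T [C0 T1 t0T HT]]] := lyap_rate hip hconv hgrad hgcont ht0 halpha hbeta hp0
    hx_deriv hxd_cont hxd_ac hN hreg hr1 hq0 hqr hpqr' l0 l1 l2 Y0.
  exists C, T; split => // t Tt; have t0t := le_trans (ltW t0T) Tt.
  rewrite /en -(lyap_energyE hip f alpha beta q p x xd lam r (z t) (lt_le_trans ht0 t0t)).
  by apply: HT => //; exact: zY.
(* For [lam] above [alpha / 2] the last coefficient of the energy may be negative. The lower bound
   [phi_ge] compensates it, using [lam * alpha <= beta] and [t^(r-q) <= t^(2r-p)]. *)
have en_ge0 lam t : 0 < lam -> lam <= 2 * alpha / 3 -> lam <= beta / alpha ->
    1 <= t -> t0 <= t -> 0 <= en lam t.
  move=> l0 l1 l2 t1 t0t; have tp := lt_le_trans ltr01 t1.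
  have la : lam * alpha <= beta by rewrite -ler_pdivlMr.
  have l3 : lam <= alpha by move: l1; rewrite ler_pdivlMr//; move: halpha; lra.
  have U0 : 0 <= `|x t - z t| ^+ 2 by rewrite exprn_ge0.
  have E1 : 1 <= t `^ (r - q) by rewrite -[leLHS](powRr0 t) ler_powR// subr_ge0.
  have h1 : t `^ (2 * r) * (c t * `|x t - z t| ^+ 2) <= t `^ (2 * r) * phi t.
    by rewrite ler_wpM2l ?powR_ge0// phi_ge.
  have h2 : lam * alpha / 2 * t `^ (r - q) * `|x t - z t| ^+ 2 <=
      t `^ (2 * r) * (c t * `|x t - z t| ^+ 2).
    rewrite mulrA ler_wpM2r// cE mulrCA -(powRD_gt0 _ _ tp).
    apply: ler_pM; rewrite ?powR_ge0 ?divr_ge0 ?mulr_ge0 ?(ltW l0) ?(ltW halpha)//.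
      by rewrite ler_wpM2r.
    by rewrite ler_powR//; move: hpqr; lra.
  have h3 : 0 <= lam * (alpha * (t `^ (r - q) - 1) + (alpha - lam)) * `|x t - z t| ^+ 2.
    rewrite mulr_ge0//; apply: mulr_ge0; first exact: ltW.
    by rewrite addr_ge0 ?subr_ge0// mulr_ge0 ?subr_ge0// ltW.
  have h4 : 0 <= lam / 2 * (r * t `^ (r - 1)) * `|x t - z t| ^+ 2.
    by rewrite mulr_ge0// !mulr_ge0 ?powR_ge0 ?divr_ge0 ?(ltW l0).
  have : 0 <= 2^-1 * `|lam *: (x t - z t) + t `^ r *: xd t| ^+ 2.
    by rewrite mulr_ge0 ?exprn_ge0.
  rewrite /en; move: h1 h2 h3 h4; lra.
(* With [lam <= alpha / 2] all three terms of the energy are nonnegative at large times, so each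
   inherits its rate. *)
pose lam := Num.min (alpha / 2) (beta / alpha).
have l0 : 0 < lam by rewrite lt_min !divr_gt0.
have lhalf : lam <= alpha / 2 by rewrite ge_min lexx.
have l1 : lam <= 2 * alpha / 3.
  by apply: (le_trans lhalf); rewrite ler_pdivlMr//; move: halpha; lra.
have l2 : lam <= beta / alpha by rewrite ge_min lexx orbT.
have [C [T [C0 T1 t0T HT]]] := en_rate lam l0 l1 l2.
have Tt0 t : T <= t -> t0 <= t by apply: le_trans; exact: ltW.
have Tt1 t : T <= t -> 1 <= t by exact: le_trans.
have Ttp t : T <= t -> 0 < t by move=> /Tt1; exact: lt_le_trans.
have xi0 t : T <= t ->
    0 <= lam / 2 * (r * t `^ (r - 1) + alpha * t `^ (r - q) - 2 * lam) * `|x t - z t| ^+ 2.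
  move=> Tt; rewrite mulr_ge0 ?exprn_ge0//; apply: mulr_ge0; first by rewrite divr_ge0// ltW.
  have h1 : 0 <= r * t `^ (r - 1) by rewrite mulr_ge0 ?powR_ge0.
  have h2 : alpha * 1 <= alpha * t `^ (r - q).
    by rewrite ler_pM2l// -[leLHS](powRr0 t) ler_powR ?subr_ge0 ?Tt1.
  move: lhalf; rewrite ler_pdivlMr//; lra.
have phi_rate t : T <= t -> phi t <= C * t `^ (r - (p + 1)).
  move=> Tt; have tp := Ttp _ Tt.
  rewrite -(ler_pM2l (powR_gt0 (2 * r) tp)) mulrCA -(powRD_gt0 _ _ tp).
  rewrite (_ : 2 * r + (r - (p + 1)) = 3 * r - (p + 1)); last by ring.
  apply: le_trans (HT _ Tt); rewrite /en lerDl.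
  by apply: addr_ge0 (xi0 _ Tt); rewrite mulr_ge0 ?exprn_ge0.
have dist_rate t : T <= t -> `|x t - z t| ^+ 2 <= 2 * C / beta * t `^ (r - 1).
  move=> Tt; have tp := Ttp _ Tt.
  have := le_trans (phi_ge t (Tt0 _ Tt)) (phi_rate _ Tt); rewrite cE.
  rewrite (_ : r - (p + 1) = (r - 1) + - p) ?(powRD_gt0 _ _ tp); last by ring.
  have h : 0 < beta / 2 * t `^ (- p) by rewrite mulr_gt0 ?divr_gt0 ?powR_gt0.
  move=> h2; rewrite -(ler_pM2l h); apply: (le_trans h2).
  by rewrite le_eqVlt; apply/orP; left; apply/eqP; field; rewrite gt_eqF.
have dist_rate1 t : T <= t -> `|x t - z t| <= Num.sqrt (2 * C / beta) * t `^ ((r - 1) / 2).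
  move=> Tt; apply: sqr_le_powR; [by []| |exact: dist_rate].
  by rewrite divr_ge0 ?mulr_ge0// ltW.
split.
- move=> lam' l0' l1' l2'; have [C' [T' [C0' T1' t0T' HT']]] := en_rate lam' l0' l1' l2'.
  exists C', T' => t Tt; have t0t : t0 <= t by apply: le_trans Tt; exact: ltW.
  rewrite enE// gee0_abs lee_fin; first exact: HT'.
  by apply: en_ge0 => //; exact: le_trans Tt.
- exists C, T => t Tt; rewrite phiE ?Tt0// gee0_abs lee_fin; first exact: phi_rate.
  by apply: phi0; exact: Tt0.
- exists (C + beta / 2 * Y ^+ 2), T => t Tt; have t0t := Tt0 _ Tt; have tp := Ttp _ Tt.
  rewrite gee0_abs; last first.
    apply: ereal_sup_ubound; exists (x t) => //; congr (_%:E).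
    by apply/eqP; rewrite eq_le minI_ge ?andbT => [|i]; rewrite ?subrr//;
      apply: (le_trans (minI_le _ ord0)); rewrite subrr.
  apply: ge_ereal_sup => _ [y _ <-]; rewrite lee_fin.
  have bnd : phi t + c t * Y ^+ 2 <= (C + beta / 2 * Y ^+ 2) * t `^ (- p).
    have : phi t <= C * t `^ (- p).
      apply: (le_trans (phi_rate _ Tt)); apply: ler_wpM2l => //.
      by apply: ler_powR; [exact: Tt1|move: hr1; lra].
    rewrite cE; lra.
  apply: le_trans bnd.
  have cY : 0 <= c t * Y ^+ 2 by rewrite mulr_ge0 ?exprn_ge0.
  (* Only points [y] improving every objective can make the minimum positive. Such a [y] is
     dominated by some [y'] of norm at most [Y], whose regularized gap is at most [phi t]; removing
     the regularization costs at most [c t * Y ^+ 2]. *)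
  have [[i fi]|nf] := pselect (exists i, f i (x t) - f i y <= 0).
    apply: le_trans (minI_le _ i) _; apply: (le_trans fi).
    by rewrite addr_ge0// phi0.
  have fy i : f i y <= f i (x t) + beta / 2 * t `^ (- p) * `|x t| ^+ 2.
    have : ~ (f i (x t) - f i y <= 0) by move=> h; apply: nf; exists i.
    move=> /negP; rewrite -ltNge.
    have : 0 <= c t * `|x t| ^+ 2 by rewrite mulr_ge0 ?exprn_ge0.
    rewrite -cE; lra.
  have [y' y'Y y'y] := HY t y t0t fy.
  have : minI (fun i => f_t f beta p t i (x t) - f_t f beta p t i y') <= phi t.
    by rewrite /phi !minI_oppmax lerN2; exact: hz.
  have [j ->] := minI_attained (fun i => f_t f beta p t i (x t) - f_t f beta p t i y').
  have := minI_le (fun i => f i (x t) - f i y) j.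
  have : c t * `|y'| ^+ 2 <= c t * Y ^+ 2 by rewrite ler_wpM2l// ler_sqr ?nnegrE.
  have : 0 <= c t * `|x t| ^+ 2 by rewrite mulr_ge0 ?exprn_ge0.
  have := y'y j; rewrite /f_t -/(c t); lra.
- by exists (Num.sqrt (2 * C / beta)), T.
- exists (Num.sqrt (2 * C) + lam * Num.sqrt (2 * C / beta)), T => t Tt.
  have tp := Ttp _ Tt; have t0t := Tt0 _ Tt.
  set w := lam *: (x t - z t) + t `^ r *: xd t.
  have w2 : `|w| ^+ 2 <= 2 * C * t `^ (3 * r - (p + 1)).
    have := HT _ Tt; have := xi0 _ Tt.
    have : 0 <= t `^ (2 * r) * phi t by rewrite mulr_ge0 ?powR_ge0 ?phi0.
    rewrite /en -/w; lra.
  have w1 := sqr_le_powR (normr_ge0 w) (mulr_ge0 (ler0n R 2) C0) w2.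
  have vE : t `^ r * `|xd t| <= `|w| + lam * `|x t - z t|.
    have -> : t `^ r * `|xd t| = `|w - lam *: (x t - z t)|.
      by rewrite /w addrAC subrr add0r normrZ ger0_norm ?powR_ge0.
    by apply: le_trans (ler_normB _ _) _; rewrite normrZ (ger0_norm (ltW l0)).
  rewrite -(ler_pM2l (powR_gt0 r tp)); apply: (le_trans vE).
  rewrite mulrCA -(powRD_gt0 _ _ tp) mulrDl; apply: lerD.
    apply: (le_trans w1); rewrite (_ : (3 * r - (p + 1)) / 2 = r + (r - (p + 1)) / 2)//.
    by field.
  rewrite -(mulrA lam); apply: ler_wpM2l; first exact: ltW.
  apply: (le_trans (dist_rate1 _ Tt)); apply: ler_wpM2l; first exact: sqrtr_ge0.
  (* The exponent comparison amounts to [p <= 2 * r], the sum of [p - q <= r] and [q <= r]. *)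
  apply: ler_powR; first exact: Tt1.
  by move: hpqr hqr; lra.
Qed.
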